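(* Let $k$ be an algebraically closed field of characteristic $p\geq3$, let $\mathfrak g=\mathfrak g_{\overline 0}\oplus\mathfrak g_{\overline 1}$ be a finite-dimensional Lie superalgebra over $k$, and let $M$ be a finite-dimensional $\mathfrak g$-supermodule. Then $$\mathcal X_{\mathfrak g}(M)=\{x\in\mathcal X_{\mathfrak g}(k): M|_{\langle x\rangle}\text{ is not free}\}\cup\{0\}.$$
   Context: $\operatorname{H}^\bullet(\mathfrak g,k)=\operatorname{Ext}^\bullet_{U(\mathfrak g)}(k,k)$ is the cohomology of the Koszul complex $(\Lambda_s(\mathfrak g^* ),\partial)$, where: $\Lambda_s(\mathfrak g^* )\cong\Lambda(\mathfrak g_{\overline 0}^* )\otimes S(\mathfrak g_{\overline 1}^* )$ is the superexterior algebra, i.e. the free graded-commutative ($ab=(-1)^{\overline a\,\overline b+\deg(a)\deg(b)}ba$) $\mathbb Z\times\mathbb Z/2$-graded superalgebra generated by $\mathfrak g^*$ in $\mathbb Z$-degree $1$; $\partial$ is the derivation ($\partial(ab)=\partial(a)b+(-1)^{\deg a}a\,\partial(b)$) whose restriction $\mathfrak g^*\to\Lambda_s^2(\mathfrak g^* )\cong[\Lambda_s^2(\mathfrak g)]^*$ is the transpose of the Lie bracket. Here $\operatorname{Ext}_{U(\mathfrak g)}^n(M,-)$ is the $n$-th right derived functor of $\operatorname{Hom}_{U(\mathfrak g)}(M,-)$ (all even and odd homomorphisms) on the abelian category of $\mathfrak g$-supermodules with even homomorphisms. For a $k$-vector space $W$, $W^{(1)}$ is $W$ with $\lambda\in k$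 acting as $\lambda^{1/p}$, and $W[p]$ means $W$ placed in $\mathbb Z$-degree $p$. The $p$-power map on $S(\mathfrak g_{\overline 1}^* )\subseteq\Lambda_s(\mathfrak g^* )$ has image consisting of cocycles and induces a homomorphism of graded superalgebras $\varphi:S(\mathfrak g_{\overline 1}^*[p])^{(1)}\to\operatorname{H}^\bullet(\mathfrak g,k)$, $f\mapsto[f^p]$ for $f\in\mathfrak g_{\overline 1}^*$. For a finite-dimensional $\mathfrak g$-supermodule $M$ let $I_{\mathfrak g}(M)$ be the annihilator ideal of the cup product action of $\operatorname{H}^\bullet(\mathfrak g,k)$ on $\operatorname{Ext}^\bullet_{U(\mathfrak g)}(M,M)$ (equivalently, the kernel of the ring homomorphism $\operatorname{H}^\bullet(\mathfrak g,k)\to\operatorname{Ext}_{U(\mathfrak g)}^\bullet(M,M)$ induced by $-\otimes M$), let $J_{\mathfrak g}(M)=\varphi^{-1}(I_{\mathfrak g}(M))$, and let $\mathcal X_{\mathfrak g}(M)=\operatorname{Max}\big(S(\mathfrak g_{\overline 1}^*[p])^{(1)}/J_{\mathfrak g}(M)\big)$. Since $S(\mathfrak g_{\overline 1}^* )^{(1)}$ has the same underlying ring as $S(\mathfrak g_{\overline 1}^* )$, its maximal ideal spectrum is identified with $\mathfrak g_{\overline 1}$, and $\mathcal X_{\mathfrak g}(M)$ is regarded as the zero locus of $J_{\mathfrak g}(M)$ in $\mathfrak g_{\overline 1}$. With this identification $\mathcal X_{\mathfrak g}(k)=\{x\in\mathfrak g_{\overline 1}:[x,x]=0\}$. For $x\in\mathcal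 X_{\mathfrak g}(k)$, $\langle x\rangle$ is the Lie sub-superalgebra of $\mathfrak g$ generated by $x$; its enveloping superalgebra is (for $x\ne0$) a one-variable exterior algebra, and ''free'' means free as a $U(\langle x\rangle)$-supermodule.
   Formalization: The supermodule M is assumed nonzero: for M = 0 the ideal J is the unit ideal, so the support variety is empty while the right-hand side contains 0. The identity [x,[x,x]] = 0 for odd x is part of the definition of a Lie superalgebra (it matters only for p = 3). *)

(* Defs.v *)
From HB Require Import structures.
From mathcomp Require Import all_boot all_order all_algebra.
From mathcomp Require Import mpoly.

Set Implicit Arguments.
Unset Strict Implicit.
Unset Printing Implicit Defensive.
Import GRing.Theory.
Local Open Scope ring_scope.

(* Parities are booleans: [false] is even, [true] is odd.  The axiom
   [x, [x, x]] = 0 is a consequence of the Jacobi identity unless the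
   characteristic is 3, where it is part of the definition of a Lie
   superalgebra (without it the Koszul differential does not square to 0). *)
Record lieSuperalgebra (k : fieldType) := LieSuperalgebra {
  lsa_sort :> vectType k;
  lpart : bool -> {vspace lsa_sort};
  lbr : lsa_sort -> lsa_sort -> lsa_sort;
  lpart_direct : directv (lpart false + lpart true);
  lpart_full : (lpart false + lpart true)%VS = fullv;
  lbr_linearl : forall y, linear (lbr^~ y);
  lbr_linearr : forall x, linear (lbr x);
  lbr_parity : forall a b x y, x \in lpart a -> y \in lpart b ->
    lbr x y \in lpart (a (+) b);
  lbr_antisym : forall a b x y, x \in lpart a -> y \in lpart b ->
    lbr x y = - ((-1) ^+ (a && b) *: lbr y x);
  lbr_jacobi : forall a b x y z, x \in lpart a -> y \in lpart b ->
    lbr x (lbr y z) = lbr (lbr x y) z + (-1) ^+ (a && b) *: lbr y (lbr x z);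
  lbr_cube : forall x, x \in lpart true -> lbr x (lbr x x) = 0
}.

(* [spr a] is the projection of V onto its part of parity a. *)
Record smodStruct (k : fieldType) (g : lieSuperalgebra k) (V : lmodType k) :=
  SmodStruct {
  spr : bool -> V -> V;
  act : g -> V -> V;
  spr_linear : forall a, linear (spr a);
  spr_proj : forall a b v, spr a (spr b v) = if a == b then spr b v else 0;
  spr_sum : forall v, spr false v + spr true v = v;
  act_linearl : forall v, linear (act^~ v);
  act_linearr : forall x, linear (act x);
  act_parity : forall a b x v, x \in lpart g a -> spr b v = v ->
    spr (a (+) b) (act x v) = act x v;
  act_lbr : forall a b x y v, x \in lpart g a -> y \in lpart g b ->
    act (lbr x y) v = act x (act y v) - (-1) ^+ (a && b) *: act y (act x v)
}.

(* No finiteness condition: injective resolutions involve infinite-dimensional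
   supermodules. *)
Record supermodule (k : fieldType) (g : lieSuperalgebra k) := Supermodule {
  sm_sort :> lmodType k;
  sm_struct : smodStruct g sm_sort
}.

Section Supermodules.
Variables (k : fieldType) (g : lieSuperalgebra k).
Implicit Types M N J : supermodule g.

Definition sproj M : bool -> M -> M := spr (sm_struct M).
Definition sact M : g -> M -> M := act (sm_struct M).

Definition parity_hom (b : bool) M N (F : M -> N) : Prop :=
  [/\ linear F,
      forall a v, sproj a v = v -> sproj (b (+) a) (F v) = F v
    & forall a x v, x \in lpart g a ->
        F (sact x v) = (-1) ^+ (a && b) *: sact x (F v)].

(* Morphisms of the abelian category of supermodules. *)
Definition even_hom M N (F : M -> N) : Prop := parity_hom false F.

(* Hom_{U(g)}(M, N): sums of an even and an odd homomorphism. *)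
Definition ghom M N (F : M -> N) : Prop :=
  exists F0 F1 : M -> N,
    [/\ parity_hom false F0, parity_hom true F1 & forall v, F v = F0 v + F1 v].

Definition injective_supermodule J : Prop :=
  forall (A B : supermodule g) (i : A -> B) (f : A -> J),
    even_hom i -> injective i -> even_hom f ->
    exists2 f' : B -> J, even_hom f' & forall v, f' (i v) = f v.

Record injective_resolution M (J : nat -> supermodule g)
    (eta : M -> J 0%N) (delta : forall b, J b -> J b.+1) : Prop :=
  InjectiveResolution {
  ires_injective : forall b, injective_supermodule (J b);
  ires_eta : even_hom eta;
  ires_delta : forall b, even_hom (@delta b);
  ires_eta_inj : injective eta;
  ires_exact0 : forall w : J 0%N,
    delta 0%N w = 0 <-> exists v, eta v = w;
  ires_exact : forall b (w : J b.+1),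
    delta b.+1 w = 0 <-> exists u, delta b u = w
}.

Lemma trivial_act_parity a b (x : g) (v : k^o) : x \in lpart g a ->
  (if b then 0 else v) = v -> (if a (+) b then 0 else 0) = 0 :> k^o.
Proof. by case: (a (+) b). Qed.

Definition trivial_struct : smodStruct g k^o.
Proof.
refine (@SmodStruct k g k^o (fun a v => if a then 0 else v) (fun _ _ => 0)
  _ _ _ _ _ trivial_act_parity _).
- by case=> // c u v; rewrite scaler0 addr0.
- by case=> [] [] v.
- by move=> v; rewrite addr0.
- by move=> v c x y; rewrite scaler0 addr0.
- by move=> x c u v; rewrite scaler0 addr0.
- by move=> a b x y v _ _; rewrite scaler0 subr0.
Defined.

Definition trivial_supermodule : supermodule g := Supermodule trivial_struct.

End Supermodules.

Section Koszul.
Variables (k : fieldType) (g : lieSuperalgebra k).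

Definition sdim (a : bool) : nat := \dim (lpart g a).

(* A homogeneous basis e_i of g; the dual basis xi_i generates Lambda_s(g^* ). *)
Definition gen : finType := ('I_(sdim false) + 'I_(sdim true))%type.
Definition gpar (i : gen) : bool := if i is inr _ then true else false.
Definition gbas (i : gen) : g :=
  match i with
  | inl j => (vbasis (lpart g false))`_j
  | inr j => (vbasis (lpart g true))`_j
  end.
Definition gdual (i : gen) (x : g) : k :=
  match i with
  | inl j => coord (vbasis (lpart g false)) j
               (daddv_pi (lpart g false) (lpart g true) x)
  | inr j => coord (vbasis (lpart g true)) j
               (daddv_pi (lpart g true) (lpart g false) x)
  end.

Definition mono0 := {set 'I_(sdim false)}.
Definition mono1 := 'X_{1..sdim true}.

(* Lambda_s(g^* ) = Lambda(g_0^* ) (x) S(g_1^* ): the element [a] stands for the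
   sum over S of xi_S * a S, where xi_S is the product in increasing order of
   the even generators xi_i, i in S. *)
Definition superext := mono0 -> {mpoly k[sdim true]}.

(* Lambda_s(g^* ) (x) V, by coefficients on the monomials xi_S * y^m; since
   these are only used one degree at a time, no finiteness of the support is
   imposed. *)
Definition cochain (V : Type) := mono0 -> mono1 -> V.
Definition mono_deg (S : mono0) (m : mono1) : nat := (#|S| + mdeg m)%N.

Section Operators.
Variable V : lmodType k.
Implicit Type c : cochain V.

(* Left multiplication by a generator.  By the rule
   ab = (-1)^(|a||b| + deg a deg b) ba, even generators anticommute with all
   generators and odd generators commute with each other. *)
Definition mulgen (i : gen) c : cochain V := fun S m =>
  match i with
  | inl j => if j \in S
             then (-1) ^+ #|[set l in S | (l < j)%N]| *: c (S :\ j) m else 0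
  | inr j => if (0 < m j)%N
             then (-1) ^+ #|S| *: c S (m - U_(j))%MM else 0
  end.

(* The left derivation d/dxi_i (contraction), of bidegree opposite to xi_i. *)
Definition dergen (i : gen) c : cochain V := fun S m =>
  match i with
  | inl j => if j \in S then 0
             else (-1) ^+ #|[set l in S | (l < j)%N]| *: c (j |: S) m
  | inr j => ((-1) ^+ #|S| * (m j).+1%:R) *: c S (m + U_(j))%MM
  end.

(* The derivation  sum_r d(xi_r) * d/dxi_r, tensored with the identity of V,
   where d is the transpose of the bracket for the pairing
   <xi xi', x x'> = (-1)^(|xi'||x|) xi(x) xi'(x') - ... on Lambda_s^2, i.e.
   d(xi_r) = 1/2 sum_(i,j) (-1)^(|i||j|) xi_r([e_i, e_j]) xi_i xi_j. *)
Definition kdiff c : cochain V := fun S m =>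
  2%:R^-1 *: \sum_(i : gen) \sum_(j : gen) \sum_(r : gen)
    ((-1) ^+ (gpar i && gpar j) * gdual r (lbr (gbas i) (gbas j)))
      *: mulgen i (mulgen j (dergen r c)) S m.

End Operators.

Definition superext_cochain (a : superext) : cochain k^o :=
  fun S m => (a S)@_m.

Definition kcocycle (a : superext) : Prop :=
  forall S m, kdiff (superext_cochain a) S m = 0.

Implicit Types M N : supermodule g.

(* Conjugation by the parity automorphisms: (-1)^|F| F for F homogeneous. *)
Definition hom_twist M N (F : M -> N) (v : M) : N :=
  let sg (L : supermodule g) (u : L) := sproj false u - sproj true u in
  sg N (F (sg M v)).

(* The action of e_i on Hom_k(M, N): e_i F - (-1)^(|i||F|) F e_i. *)
Definition hom_act M N (i : gen) (F : M -> N) (v : M) : N :=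
  sact (gbas i) (F v)
    - (if gpar i then hom_twist F else F) (sact (gbas i) v).

(* The Koszul differential of Lambda_s(g^* ) (x) Hom_k(M, N), that is, of
   Hom_{U(g)}(Y (x) M, N) with Y -> k the Koszul resolution:
   D(a (x) F) = d a (x) F + (-1)^(deg a) a D(F),
   D(F) = - sum_i xi_i (x) e_i F. *)
Definition hom_kdiff M N (c : cochain (M -> N)) : cochain (M -> N) :=
  fun S m v =>
    kdiff (fun S' m' => c S' m' v) S m
    - \sum_(i : gen)
        mulgen i (fun S' m' =>
          (-1) ^+ (gpar i && odd (mdeg m')) *: hom_act i (c S' m') v) S m.

(* The image under - (x) M of the class of the component of degree n of the
   cocycle [a], in Ext^n(M, M) = H^n(Hom_{U(g)}(M, J)).  The cocycle a_n (x) id_M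
   of Hom_{U(g)}(Y_n (x) M, M) is compared with J by the usual descent from the
   resolution Y (x) M of M to the resolution J of M: starting from
   eta (a_n (x) id_M), each t b is lifted through D to h b, and pushed to J (b+1)
   by delta.  Signs, which depend on n only, are ignored. *)
Definition tensor_class M (J : nat -> supermodule g)
    (eta : M -> J 0%N) (delta : forall b, J b -> J b.+1)
    (n : nat) (a : superext) (z : M -> J n) : Prop :=
  exists t h : forall b, cochain (M -> J b),
    [/\ forall S m v, mono_deg S m = n -> t 0%N S m v = eta ((a S)@_m *: v),
        forall b, (b < n)%N ->
          [/\ forall S m, linear (h b S m),
              forall S m v, mono_deg S m = (n - b)%N ->
                hom_kdiff (h b) S m v = t b S m v
            & forall S m v, mono_deg S m = (n - b.+1)%N ->
                t b.+1 S m v = delta b (h b S m v)]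
      & forall v, z v = t n set0 0%MM v].

Definition ext_coboundary M (J : nat -> supermodule g)
    (delta : forall b, J b -> J b.+1) (n : nat) : (M -> J n) -> Prop :=
  match n with
  | 0%N => fun z => forall v, z v = 0
  | n'.+1 => fun z =>
      exists2 s : M -> J n', ghom s & forall v, z v = delta n' (s v)
  end.

(* I_g(M), on representatives of cohomology classes: the kernel of the ring
   homomorphism H(g, k) -> Ext(M, M) induced by - (x) M.  The map is graded and
   does not depend on the injective resolution nor on the representing z. *)
Definition annI M (a : superext) : Prop :=
  kcocycle a /\
  exists (J : nat -> supermodule g) (eta : M -> J 0%N)
         (delta : forall b, J b -> J b.+1),
    injective_resolution eta delta /\
    forall n, exists2 z : M -> J n,
      tensor_class eta delta a z & ext_coboundary delta z.

(* phi : S(g_1^* [p])^(1) -> H(g, k) sends a polynomial f to the class of f^p;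
   the Frobenius twist does not change the underlying ring S(g_1^* ). *)
Definition phi (p : nat) (f : {mpoly k[sdim true]}) : superext :=
  fun S => if S == set0 then f ^+ p else 0.

Definition J_ideal (p : nat) M (f : {mpoly k[sdim true]}) : Prop :=
  annI M (phi p f).

Definition supp_var (p : nat) M (x : g) : Prop :=
  x \in lpart g true /\
  forall f, J_ideal p M f -> f.@[fun j => gdual (inr j) x] = 0.

(* For x odd with [x, x] = 0, U(<x>) has basis 1, x if x != 0, and 1 if x = 0. *)
Definition free_over (V : vectType k) (M : smodStruct g V) (x : g) : Prop :=
  exists2 B : seq V,
    forall v, v \in B -> exists b, spr M b v = v &
    basis_of fullv (B ++ if x == 0 then [::] else [seq act M x v | v <- B]).

End Koszul.

Arguments trivial_supermodule {k} g.

(* Main.v *)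
(** If f^p kills the identity class, then f^p id_M is a coboundary in the complex
    of cochains with values in End(M); setting xi_i = 0 and y_j = y_j(x) turns the
    differential into the commutator with x, so f(x) <> 0 makes id_M nullhomotopic
    for the square-zero operator x, that is, M free over <x>.

    Conversely let D be the differential of Lambda_s(g^* ) (x) M.  When
    [x, x] <> 0, let s be the multiplication by an even generator alpha with
    alpha([x, x]) <> 0; when M is free over <x>, let s = s_0 [D, s_0] for a
    contraction s_0 of M over <x>.  Then w = D s + s D commutes with D and, modulo
    the nilpotent ideal of the generators of g_0^* , acts as a matrix over S(g_1^* )
    that is invertible at x.  By Cayley-Hamilton some chi(w) is nilpotent with
    chi_0(x) <> 0.  A large power p^(e+1) of this relation has coefficients
    chi_i^(p^(e+1)) commuting with D, hence chi_0^(p^(e+1)) is nullhomotopic and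
    f = chi_0^(p^e) annihilates the identity class without vanishing at x. *)

Require Import Defs.
From HB Require Import structures.
From mathcomp Require Import all_boot all_order all_algebra.
From mathcomp Require classical_sets.
From mathcomp Require Import boolp functions.
From mathcomp Require Import mpoly ring.

Set Implicit Arguments.
Unset Strict Implicit.
Unset Printing Implicit Defensive.
Import GRing.Theory.
Local Open Scope ring_scope.

(** * Linear algebra *)

(** The annihilator is defined through an injective resolution, which costs work on both sides: a
    class that vanishes must be pulled back along the descent until it bounds in Koszul cochains
    evaluated at x, and for the converse a resolution must be produced, which coinduced modules
    supply. A nullhomotopy of f^p id_M must be even for the parity, whereas a contraction s_0 over
    <x> is odd. Its commutator u = [D, s_0] is odd too and anticommutes with D, so s = s_0 u is even
    and D s + s D = u^2. The coefficients chi_i themselves do not commute with D: the Koszul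
    differential derives them, and the generators of g_0^* anticommute with monomials of odd degree.
    Raising to a p-th power removes the first defect; the second is avoided by working with a square
    of a matrix of linear forms, or with a quadratic form, so that only even degrees occur. In
    characteristic 3 the vanishing of d^2 on an even generator does not follow from the Jacobi
    identity by summing over cyclic permutations and dividing by 3; terms are sorted by a
    distinguished index instead. *)

Section Submodules.
Variables (k : fieldType) (V : lmodType k) (P : V -> Prop).
Hypothesis P_closed : P 0 /\ forall a u v, P u -> P v -> P (a *: u + v).

(** Carrying the closure proof as an argument lets instance inference recover the submodule
    structure from the predicate alone. Membership is the classical truth value of [P]. *)
Definition subm_pred of (P 0 /\ forall a u v, P u -> P v -> P (a *: u + v))
  : {pred V} := fun v => `[< P v >].

Fact subm_pred_closed : submod_closed (subm_pred P_closed).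
Proof.
case: (P_closed) => P0 PD; split=> [|a u v]; rewrite /in_mem /=.
  exact/asboolP.
by move=> /asboolP Pu /asboolP Pv; apply/asboolP/PD.
Qed.
HB.instance Definition _ :=
  GRing.isSubmodClosed.Build k V (subm_pred P_closed) subm_pred_closed.

Record subm := Subm { subm_val :> V; subm_valP : subm_val \in subm_pred P_closed }.
HB.instance Definition _ := [isSub for subm_val].
HB.instance Definition _ := [Choice of subm by <:].
HB.instance Definition _ := [SubChoice_isSubLmodule of subm by <:].

Lemma submP (u : subm) : P u.
Proof. exact/asboolP/(subm_valP u). Qed.

Definition mksubm (v : V) (Pv : P v) : subm := @Subm v (asboolT Pv).

Lemma subm_inj (u v : subm) : u = v :> V -> u = v.
Proof. exact: val_inj. Qed.

End Submodules.

Section LinearMaps.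
Variables (k : fieldType).
Implicit Types U V W : lmodType k.

Section Rules.
Variables (U V : lmodType k) (f : U -> V) (f_lin : linear f).

Lemma lin0 : f 0 = 0.
Proof. by rewrite -(addNr 0) -scaleN1r f_lin scaleN1r addNr. Qed.
Lemma linZ a u : f (a *: u) = a *: f u.
Proof. by rewrite -(addr0 (a *: u)) f_lin lin0 addr0. Qed.
Lemma linD u v : f (u + v) = f u + f v.
Proof. by rewrite -[u in LHS]scale1r f_lin scale1r. Qed.
Lemma linN u : f (- u) = - f u.
Proof. by rewrite -scaleN1r linZ scaleN1r. Qed.
Lemma linB u v : f (u - v) = f u - f v.
Proof. by rewrite linD linN. Qed.
Lemma lin_sum I (r : seq I) (P : pred I) F :
  f (\sum_(i <- r | P i) F i) = \sum_(i <- r | P i) f (F i).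
Proof.
by elim/big_rec2: _ => [|i u v _ <-]; rewrite ?lin0 ?linD.
Qed.
End Rules.

Lemma comp_linear U V W (f : V -> W) (h : U -> V) :
  linear f -> linear h -> linear (f \o h).
Proof. by move=> fl hl a u v /=; rewrite hl fl. Qed.

Section Extension.
Variables (A B W : lmodType k) (i : A -> B) (f : A -> W).
Hypotheses (i_lin : linear i) (i_inj : injective i) (f_lin : linear f).

Let good (R : B -> W -> Prop) :=
  [/\ forall a, R (i a) (f a),
      forall c u m v n, R u m -> R v n -> R (c *: u + v) (c *: m + n)
    & forall m, R 0 m -> m = 0].

Let good0 : good (fun u m => exists a, u = i a /\ m = f a).
Proof.
split=> [a|c u m v n [a [-> ->]] [b [-> ->]]|m [a [a0 ->]]].
- by exists a.
- by exists (c *: a + b); rewrite i_lin f_lin.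
- by rewrite (i_inj (_ : i a = i 0)) ?lin0.
Qed.

(** Zorn's lemma, applied to single-valued linear relations containing the graph of [f] along [i].
    [B] is arbitrary because injectivity is tested against infinite-dimensional supermodules. *)
Lemma linear_extension : exists2 f' : B -> W, linear f' & forall a, f' (i a) = f a.
Proof.
pose T := {R | good R}.
pose le (R R' : T) := `[< forall u m, sval R u m -> sval R' u m >].
have lexx t : le t t by apply/asboolP.
have [|||[R gR] Rmax] := @classical_sets.Zorn T le lexx.
- by move=> r s t /asboolP rs /asboolP st; apply/asboolP => u m /rs /st.
- move=> [r gr] [s gs] /asboolP/= rs /asboolP/= sr; apply: eq_exist.
  by apply/funext => u; apply/funext => m; apply/propext; split=> [/rs|/sr].
(* A nonempty chain is bounded by its union, the empty one by the graph of [f] itself, [good0]. *)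
- move=> C totC; have [[R0 CR0]|C0] := pselect (exists R0, C R0); last first.
    by exists (exist _ _ good0) => s Cs; case: C0; exists s.
  have gU : good (fun u m => exists2 R, C R & sval R u m).
    split=> [a|c u m v n [R CR Rum] [S CS Svn]|m [R _]].
    + by exists R0 => //; case: (svalP R0).
    + case: (totC R S CR CS) => /asboolP RS.
        by exists S => //; case: (svalP S) => _ + _; apply=> //; apply: RS.
      by exists R => //; case: (svalP R) => _ + _; apply=> //; apply: RS.
    + by case: (svalP R) => _ _; apply.
  by exists (exist _ _ gU) => s Cs; apply/asboolP => u m sum; exists s.
have [Ri RD R0] := gR.
have RZ c u m : R u m -> R (c *: u) (c *: m).
  have R00 : R 0 0 by have := Ri 0; rewrite !lin0.
  by move=> /(RD c)/(_ R00); rewrite !addr0.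
have Rfun u m n : R u m -> R u n -> m = n.
  move=> Rm Rn; apply/eqP; rewrite -subr_eq0; apply/eqP/R0.
  by have := RD (-1) _ _ _ _ Rn Rm; rewrite !scaleN1r addNr addrC.
have Rtot u : exists m, R u m.
  apply: contrapT => nRu.
  (* A vector outside the domain can be adjoined with value 0, which contradicts maximality. *)
  pose R' v m := exists c, R (v - c *: u) m.
  have gR' : good R'.
    split=> [a|c v m w n [d Rd] [e Re]|m [c]].
    + by exists 0; rewrite scale0r subr0.
    + exists (c * d + e); have := RD c _ _ _ _ Rd Re.
      by rewrite scalerDl scalerBr scalerA opprD addrACA.
    + rewrite sub0r -scaleNr => Rcm; have [c0|c0] := eqVneq c 0.
        by move: Rcm; rewrite c0 oppr0 scale0r => /R0.
      have /(RZ (- c)^-1) := Rcm; rewrite scalerA mulVf ?oppr_eq0 // scale1r.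
      by move=> Ru; case: nRu; eexists; exact: Ru.
  have leR : le (exist _ R gR) (exist _ R' gR').
    by apply/asboolP => v m /= Rvm; exists 0; rewrite scale0r subr0.
  have /(congr1 sval)/= eR := Rmax _ leR.
  apply: nRu; exists 0; rewrite -eR; exists 1; rewrite scale1r subrr.
  by have := Ri 0; rewrite !lin0.
have [f' f'P] := choice Rtot; exists f'.
  by move=> c u v; apply: Rfun (f'P _) _; apply: RD.
by move=> a; apply: Rfun (f'P _) _.
Qed.
End Extension.

(** Choose preimages of a basis. In this form exactness of a resolution is applied to merely
    k-linear maps out of a finite-dimensional module. *)
Lemma linear_lift (V : vectType k) U W (F : V -> W) (h : U -> W) :
  linear F -> linear h -> (forall v, exists u, h u = F v) ->
  exists2 G : V -> U, linear G & forall v, h (G v) = F v.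
Proof.
move=> Fl hl hF; have [u uP] := choice hF.
pose b := vbasis {:V}.
exists (fun v => \sum_i coord b i v *: u b`_i).
  move=> a v w; rewrite scaler_sumr -big_split; apply: eq_bigr => i _ /=.
  by rewrite linearP scalerDl scalerA.
move=> v; rewrite (lin_sum hl) [in RHS](coord_vbasis (memvf v)) (lin_sum Fl).
by apply: eq_bigr => i _; rewrite (linZ hl) (linZ Fl) uP.
Qed.

End LinearMaps.

(** * Structure constants *)

Section Basis.
Variables (k : fieldType) (g : lieSuperalgebra k).
Implicit Types (i j r : gen g) (x y : g).

Lemma gbas_par i : gbas i \in lpart g (gpar i).
Proof. by case: i => j /=; rewrite vbasis_mem // mem_nth // size_tuple. Qed.

Lemma gdual_linear i : linear (gdual i : g -> k^o).
Proof. by move=> a x y; case: i => j /=; rewrite linearP linearP. Qed.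

Lemma gdualD i x y : gdual i (x + y) = gdual i x + gdual i y.
Proof. by rewrite (linD (@gdual_linear i)). Qed.
Lemma gdualZ i a x : gdual i (a *: x) = a * gdual i x.
Proof. by rewrite (linZ (@gdual_linear i)). Qed.
Lemma gdual_sum i I (s : seq I) (P : pred I) F :
  gdual i (\sum_(l <- s | P l) F l) = \sum_(l <- s | P l) gdual i (F l).
Proof. by rewrite (lin_sum (@gdual_linear i)). Qed.

Lemma lpart_capv : (lpart g false :&: lpart g true = 0)%VS.
Proof. exact/directv_addP/lpart_direct. Qed.

Lemma gdual_par i a x : x \in lpart g a -> gpar i != a -> gdual i x = 0.
Proof.
have daddv0 (U W : {vspace g}) z : (U :&: W = 0)%VS -> z \in W -> daddv_pi U W z = 0.
  move=> UW zW; have WU : (W :&: U = 0)%VS by rewrite capvC.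
  have := daddv_pi_add UW (subvP (addvSr U W) z zW).
  by rewrite (daddv_pi_id WU zW) => /(canRL (addrK _)); rewrite subrr.
case: i a => j [] //= xg _; rewrite daddv0 ?linear0 //; first exact: lpart_capv.
by rewrite capvC; exact: lpart_capv.
Qed.

Lemma gbas_decomp x : x = \sum_i gdual i x *: gbas i.
Proof.
rewrite big_sumType /=.
have xf : x \in (lpart g false + lpart g true)%VS by rewrite lpart_full memvf.
rewrite -{1}(daddv_pi_add lpart_capv xf).
by congr (_ + _); rewrite {1}(coord_vbasis (memv_pi _ _ _)).
Qed.

Lemma gdual_bas i j : gdual i (gbas j) = (i == j)%:R.
Proof.
have [Eij|Nij] := boolP (gpar i == gpar j); last first.
  rewrite (gdual_par (gbas_par j) Nij); case: eqP => // Eij.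
  by rewrite Eij eqxx in Nij.
case: i j Eij => i [] j //= _.
- rewrite daddv_pi_id ?vbasis_mem ?mem_nth ?size_tuple //; last exact: lpart_capv.
  by rewrite coord_free ?(basis_free (vbasisP _)) // eq_sym.
- rewrite daddv_pi_id ?vbasis_mem ?mem_nth ?size_tuple //.
    by rewrite coord_free ?(basis_free (vbasisP _)) // eq_sym.
  by rewrite capvC; exact: lpart_capv.
Qed.

Definition strc i j r : k := gdual r (lbr (gbas i) (gbas j)).

Lemma lbr_bas i j : lbr (gbas i) (gbas j) = \sum_r strc i j r *: gbas r.
Proof. exact: gbas_decomp. Qed.

Lemma strc_par i j r : strc i j r != 0 -> gpar r = gpar i (+) gpar j.
Proof.
move=> c0; apply/eqP; apply: contraNT c0 => Nr; apply/eqP.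
by apply: gdual_par Nr; apply: lbr_parity; apply: gbas_par.
Qed.

Definition ksign i j : k := (-1) ^+ (gpar i && gpar j).

Lemma strc_antisym i j r : strc i j r = - (ksign i j * strc j i r).
Proof.
rewrite /strc (lbr_antisym (gbas_par i) (gbas_par j)).
by rewrite -scaleN1r !gdualZ mulN1r.
Qed.

Lemma gdual_lbr x y r :
  gdual r (lbr x y) = \sum_i \sum_j (gdual i x * gdual j y) * strc i j r.
Proof.
rewrite {1}(gbas_decomp x) (lin_sum (lbr_linearl y)) gdual_sum.
apply: eq_bigr => i _; rewrite (linZ (lbr_linearl y)) gdualZ.
rewrite [X in lbr _ X](gbas_decomp y) (lin_sum (lbr_linearr _)) gdual_sum mulr_sumr.
by apply: eq_bigr => j _; rewrite (linZ (lbr_linearr _)) gdualZ mulrA.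
Qed.

End Basis.

(** * Injective resolutions *)

Section SupermoduleTheory.
Variables (k : fieldType) (g : lieSuperalgebra k).

Section Rules.
Variables (V : lmodType k) (M : smodStruct g V).
Implicit Types (v : V).

Lemma sprD a u v : spr M a (u + v) = spr M a u + spr M a v.
Proof. exact: (linD (spr_linear M a)). Qed.
Lemma sprZ a c v : spr M a (c *: v) = c *: spr M a v.
Proof. exact: (linZ (spr_linear M a)). Qed.
Lemma sprB a u v : spr M a (u - v) = spr M a u - spr M a v.
Proof. exact: (linB (spr_linear M a)). Qed.
Lemma spr0 a : spr M a 0 = 0.
Proof. exact: (lin0 (spr_linear M a)). Qed.
Lemma actD x u v : act M x (u + v) = act M x u + act M x v.
Proof. exact: (linD (act_linearr M x)). Qed.
Lemma actZ x c v : act M x (c *: v) = c *: act M x v.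
Proof. exact: (linZ (act_linearr M x)). Qed.
Lemma actN x v : act M x (- v) = - act M x v.
Proof. exact: (linN (act_linearr M x)). Qed.
Lemma actB x u v : act M x (u - v) = act M x u - act M x v.
Proof. exact: (linB (act_linearr M x)). Qed.
Lemma act0 x : act M x 0 = 0.
Proof. exact: (lin0 (act_linearr M x)). Qed.
Lemma act_suml v I (s : seq I) (P : pred I) F :
  act M (\sum_(i <- s | P i) F i) v = \sum_(i <- s | P i) act M (F i) v.
Proof. exact: (lin_sum (act_linearl M v)). Qed.
Lemma act0l v : act M 0 v = 0.
Proof. exact: (lin0 (act_linearl M v)). Qed.
Lemma actZl c x v : act M (c *: x) v = c *: act M x v.
Proof. exact: (linZ (act_linearl M v)). Qed.

Lemma act_bas x v : act M x v = \sum_i gdual i x *: act M (gbas i) v.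
Proof. by rewrite {1}(gbas_decomp x) act_suml; apply: eq_bigr => i _; rewrite actZl. Qed.

Lemma spr_id a v : spr M a (spr M a v) = spr M a v.
Proof. by rewrite spr_proj eqxx. Qed.

Lemma spr_act a b x v : x \in lpart g a ->
  spr M b (act M x v) = act M x (spr M (b (+) a) v).
Proof.
move=> xa; have spra c : spr M b (act M x (spr M c v)) =
    if b == a (+) c then act M x (spr M c v) else 0.
  rewrite -{1}(act_parity xa (spr_id c v)) spr_proj.
  by rewrite (act_parity xa (spr_id c v)).
rewrite -{1}(spr_sum M v) actD sprD !spra.
by case: a xa {spra} b => xa [] /=; rewrite ?addr0 ?add0r.
Qed.

Lemma spr_neq a b v : spr M a v = v -> a != b -> spr M b v = 0.
Proof. by move=> <- ab; rewrite spr_proj eq_sym (negPf ab). Qed.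

Lemma act_gbas_commute i j v :
  act M (gbas i) (act M (gbas j) v)
    - ksign i j *: act M (gbas j) (act M (gbas i) v)
  = \sum_r strc i j r *: act M (gbas r) v.
Proof.
rewrite -(act_lbr _ _ (gbas_par i) (gbas_par j)) lbr_bas act_suml.
by apply: eq_bigr => r _; rewrite actZl.
Qed.
End Rules.

Section FromBasis.
Variables (V : lmodType k) (pr : bool -> V -> V) (T : gen g -> V -> V).
Hypotheses (pr_linear : forall a, linear (pr a))
  (pr_proj : forall a b v, pr a (pr b v) = if a == b then pr b v else 0)
  (pr_sum : forall v, pr false v + pr true v = v)
  (T_linear : forall i, linear (T i))
  (pr_T : forall i b v, pr b (T i v) = T i (pr (b (+) gpar i) v))
  (T_commute : forall i j v,
     T i (T j v) - ksign i j *: T j (T i v) = \sum_r strc i j r *: T r v).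

Let tact (x : g) v := \sum_i gdual i x *: T i v.

Let tact_linearr x : linear (tact x).
Proof.
move=> a u v; rewrite /tact scaler_sumr -big_split; apply: eq_bigr => i _ /=.
by rewrite T_linear scalerDr !scalerA mulrC.
Qed.

Let tact_parity a b x v : x \in lpart g a -> pr b v = v ->
  pr (a (+) b) (tact x v) = tact x v.
Proof.
move=> xa vb; rewrite (lin_sum (pr_linear _)); apply: eq_bigr => i _.
rewrite (linZ (pr_linear _)) pr_T; case: (eqVneq (gpar i) a) => [->|Na].
  by rewrite addbAC addbb vb.
by rewrite (gdual_par xa Na) !scale0r.
Qed.

Let tact_lbr a b x y v : x \in lpart g a -> y \in lpart g b ->
  tact (lbr x y) v = tact x (tact y v) - (-1) ^+ (a && b) *: tact y (tact x v).
Proof.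
move=> xa yb.
have ts z w : tact z (tact w v) = \sum_i \sum_j (gdual i z * gdual j w) *: T i (T j v).
  rewrite {1}/tact; apply: eq_bigr => i _.
  rewrite (lin_sum (T_linear i)) scaler_sumr; apply: eq_bigr => j _.
  by rewrite (linZ (T_linear i)) scalerA.
rewrite !ts [X in _ - _ *: X]exchange_big scaler_sumr -sumrB /=.
have lbrE : tact (lbr x y) v =
    \sum_i \sum_j (gdual i x * gdual j y) *: \sum_r strc i j r *: T r v.
  rewrite {1}(gbas_decomp x) (lin_sum (lbr_linearl y)) {1}/tact.
  rewrite (eq_bigr (fun r => \sum_i
      (gdual r (lbr (gdual i x *: gbas i) y) *: T r v))); last first.
    by move=> r _; rewrite gdual_sum scaler_suml.
  rewrite exchange_big; apply: eq_bigr => i _ /=.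
  rewrite (linZ (lbr_linearl y)) [in LHS](gbas_decomp y) (lin_sum (lbr_linearr _)).
  rewrite (eq_bigr (fun r => \sum_j
      (gdual i x * gdual j y) *: (strc i j r *: T r v))); last first.
    move=> r _; rewrite gdualZ gdual_sum mulr_sumr scaler_suml.
    apply: eq_bigr => j _; rewrite (linZ (lbr_linearr _)) gdualZ mulrA.
    by rewrite scalerA.
  by rewrite exchange_big; apply: eq_bigr => j _; rewrite scaler_sumr.
rewrite lbrE; apply: eq_bigr => i _.
rewrite scaler_sumr -sumrB; apply: eq_bigr => j _ /=.
rewrite -T_commute scalerBr !scalerA; congr (_ - _ *: _).
rewrite [in RHS]mulrC (mulrC (gdual j y)).
case: (eqVneq (gpar i) a) => [Ei|Ni]; last first.
  by rewrite (gdual_par xa Ni) !(mul0r, mulr0).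
case: (eqVneq (gpar j) b) => [Ej|Nj]; last first.
  by rewrite (gdual_par yb Nj) !(mul0r, mulr0).
by rewrite /ksign Ei Ej.
Qed.

(** The module axioms need only be checked on the homogeneous basis of g: both sides of the bracket
    relation are bilinear, and coordinates of the wrong parity vanish. *)
Definition smod_of_basis : smodStruct g V.
Proof.
refine (@SmodStruct k g V pr tact pr_linear pr_proj pr_sum _ tact_linearr
  tact_parity tact_lbr).
move=> v a x y; rewrite /tact scaler_sumr -big_split; apply: eq_bigr => i _ /=.
by rewrite gdualD gdualZ scalerDl scalerA.
Defined.

Lemma act_smod_of_basis i v : act smod_of_basis (gbas i) v = T i v.
Proof.
rewrite /= /tact (bigD1 i) //= gdual_bas eqxx scale1r big1 ?addr0 // => j Nj.
by rewrite gdual_bas (negPf Nj) scale0r.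
Qed.
End FromBasis.

(** * Coinduced supermodules *)

Section Cofree.
Variables (V : lmodType k) (M : smodStruct g V).
Implicit Types (phi : seq (gen g) -> V) (w : seq (gen g)).

(** These are the relations of U(g) inserted between two words. Functions on words obeying them are
    the functionals on the tensor algebra that kill the defining ideal, so the dual of U(g) is
    available without a basis of U(g). *)
Definition word_rel phi : Prop := forall w w' i j,
  phi (w ++ [:: i, j & w']) - ksign i j *: phi (w ++ [:: j, i & w'])
  = \sum_r strc i j r *: phi (w ++ r :: w').

Fact word_rel_closed : word_rel 0 /\
  forall a phi psi, word_rel phi -> word_rel psi -> word_rel (a *: phi + psi).
Proof.
split=> [|a phi psi rphi rpsi] w w' i j.
  by rewrite scaler0 subr0 big1 // => r _; rewrite scaler0.
under eq_bigr => r _ do rewrite scalerDr scalerA mulrC -scalerA.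
rewrite big_split -scaler_sumr -rphi -rpsi /= !fctE.
by rewrite scalerDr opprD addrACA scalerBr !scalerA (mulrC a).
Qed.

(* The supermodule Hom_k(U(g), V) coinduced from V: a functional on U(g) is
   given by its values on the words in the basis of g. *)
Definition cofree_sort : lmodType k := subm word_rel_closed.

Definition wpar w : bool := foldr (fun i b => gpar i (+) b) false w.

Lemma wpar_cat w w' : wpar (w ++ w') = wpar w (+) wpar w'.
Proof. by elim: w => //= i w ->; rewrite addbA. Qed.

Fact cofree_pr_subproof a (phi : cofree_sort) :
  word_rel (fun w => spr M (a (+) wpar w) (subm_val phi w)).
Proof.
move=> w w' i j.
rewrite (_ : wpar (w ++ [:: i, j & w']) = wpar w (+) (gpar i (+) gpar j (+) wpar w'));
  last by rewrite wpar_cat /= -addbA.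
rewrite (_ : wpar (w ++ [:: j, i & w']) = wpar w (+) (gpar i (+) gpar j (+) wpar w'));
  last by rewrite wpar_cat /= -addbA; congr (_ (+) _); exact: addbCA.
rewrite -sprZ -sprB (submP phi) (lin_sum (spr_linear _ _)).
apply: eq_bigr => r _; rewrite sprZ wpar_cat /=.
have [->|/strc_par ->] := eqVneq (strc i j r) 0; first by rewrite !scale0r.
by rewrite !addbA.
Qed.
(** [phi w] is to be read as the value at the empty word of w acting on [phi]; hence the shift of
    the parity by [wpar w]. *)
Definition cofree_pr a (phi : cofree_sort) : cofree_sort :=
  mksubm word_rel_closed (cofree_pr_subproof a phi).

Fact cofree_shift_subproof i (phi : cofree_sort) :
  word_rel (fun w => subm_val phi (rcons w i)).
Proof.
move=> w w' j l; rewrite !rcons_cat /= (submP phi).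
by apply: eq_bigr => r _; rewrite rcons_cat.
Qed.
(** Right translation: under the same reading the letter [i] acts before [w], so it is appended on
    the right, and no sign arises. *)
Definition cofree_shift i (phi : cofree_sort) : cofree_sort :=
  mksubm word_rel_closed (cofree_shift_subproof i phi).

Lemma cofree_ext (phi psi : cofree_sort) :
  (forall w, subm_val phi w = subm_val psi w) -> phi = psi.
Proof. by move=> E; apply: subm_inj; apply/funext. Qed.

Lemma cofreeD (phi psi : cofree_sort) w :
  subm_val (phi + psi) w = subm_val phi w + subm_val psi w.
Proof. by []. Qed.
Lemma cofreeZ c (phi : cofree_sort) w :
  subm_val (c *: phi) w = c *: subm_val phi w.
Proof. by []. Qed.
Lemma cofreeB (phi psi : cofree_sort) w :
  subm_val (phi - psi) w = subm_val phi w - subm_val psi w.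
Proof. by []. Qed.
Lemma cofree_sum I (s : seq I) (P : pred I) (F : I -> cofree_sort) w :
  subm_val (\sum_(i <- s | P i) F i) w = \sum_(i <- s | P i) subm_val (F i) w.
Proof. by elim/big_rec2: _ => // i u v _ <-. Qed.

Definition cofree_struct : smodStruct g cofree_sort.
Proof.
refine (@smod_of_basis cofree_sort cofree_pr cofree_shift _ _ _ _ _ _).
- by move=> a c phi psi; apply: cofree_ext => w; rewrite /= !fctE sprD sprZ.
- move=> a b phi; apply: cofree_ext => w /=; rewrite spr_proj.
  rewrite (can_eq (addbK _)).
  by case: eqP.
- move=> phi; apply: cofree_ext => w; rewrite cofreeD /=.
  by case: (wpar w); rewrite /= ?spr_sum // addrC spr_sum.
- by move=> i c phi psi; apply: cofree_ext.
- move=> i b phi; apply: cofree_ext => w /=.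
  by rewrite -cats1 wpar_cat /= addbF -!addbA (addbC (gpar i)) -addbA addbb addbF.
- move=> i j phi; apply: cofree_ext => w.
  rewrite cofree_sum cofreeB cofreeZ /= -!cats1 -!catA /= (submP phi).
  by apply: eq_bigr => r _; rewrite cats1.
Defined.

Lemma cofree_act_gbas i (phi : cofree_sort) w :
  subm_val (act cofree_struct (gbas i) phi) w = subm_val phi (rcons w i).
Proof. by rewrite act_smod_of_basis. Qed.

Definition wact w (v : V) : V := foldr (fun i => act M (gbas i)) v w.

Lemma wact_linear w : linear (wact w).
Proof. by move=> a u v; elim: w => //= i w ->; rewrite act_linearr. Qed.

Fact cofree_unit_subproof v : word_rel (wact^~ v).
Proof.
move=> w w' i j; rewrite /wact !foldr_cat /= -/(wact w) -/(wact w).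
rewrite -(linZ (wact_linear w)) -(linB (wact_linear w)) act_gbas_commute.
rewrite (lin_sum (wact_linear w)); apply: eq_bigr => r _.
by rewrite (linZ (wact_linear w)) foldr_cat.
Qed.
Definition cofree_unit v : cofree_sort :=
  mksubm word_rel_closed (cofree_unit_subproof v).

Lemma cofree_unit_linear : linear cofree_unit.
Proof. by move=> a u v; apply: cofree_ext => w; apply: wact_linear. Qed.

Lemma cofree_unit_act x v :
  cofree_unit (act M x v) = act cofree_struct x (cofree_unit v).
Proof.
rewrite (act_bas _ _ (cofree_unit v)) (act_bas _ _ v).
rewrite (lin_sum cofree_unit_linear); apply: eq_bigr => i _.
rewrite (linZ cofree_unit_linear); congr (_ *: _).
by apply: cofree_ext => w; rewrite cofree_act_gbas /= /wact foldr_rcons.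
Qed.

Lemma cofree_unit_pr a v : cofree_pr a (cofree_unit v) = cofree_unit (spr M a v).
Proof.
apply: cofree_ext => w /=; elim: w a => [|i w IH] a /=; first by rewrite addbF.
by rewrite (spr_act _ _ _ (gbas_par i)) -addbA (addbC (gpar i)) -addbA addbb addbF IH.
Qed.

Lemma cofree_unit_inj : injective cofree_unit.
Proof. by move=> u v /(congr1 (fun phi : cofree_sort => subm_val phi [::])). Qed.

End Cofree.

Definition cofree (M : supermodule g) : supermodule g :=
  Supermodule (cofree_struct (sm_struct M)).

Lemma even_homP (M N : supermodule g) (F : M -> N) :
  linear F -> (forall a v, sproj a (F v) = F (sproj a v)) ->
  (forall x v, F (sact x v) = sact x (F v)) -> even_hom F.
Proof.
move=> Fl Fp Fa; split=> // [a v va|a x v _]; first by rewrite Fp va.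
by rewrite andbF expr0 scale1r.
Qed.

Lemma even_hom_linear (M N : supermodule g) (F : M -> N) : even_hom F -> linear F.
Proof. by case. Qed.

Lemma even_hom_proj (M N : supermodule g) (F : M -> N) a v :
  even_hom F -> sproj a (F v) = F (sproj a v).
Proof.
case=> Fl Fp _; rewrite -{1}(spr_sum (sm_struct M) v) (linD Fl) /sproj sprD.
have H b : spr (sm_struct N) b (F (spr (sm_struct M) b v)) = F (spr (sm_struct M) b v).
  by apply: (Fp b); apply: spr_id.
rewrite -(H false) -(H true) !spr_proj.
by case: a => /=; rewrite ?H ?add0r ?addr0.
Qed.

Lemma gbas_split (x : g) : exists x0 x1 : g,
  [/\ x = x0 + x1, x0 \in lpart g false & x1 \in lpart g true].
Proof.
have : x \in (lpart g false + lpart g true)%VS by rewrite lpart_full memvf.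
by case/memv_addP => x0 x0g [x1 x1g ->]; exists x0, x1.
Qed.

Lemma even_hom_act (M N : supermodule g) (F : M -> N) x v :
  even_hom F -> F (sact x v) = sact x (F v).
Proof.
case=> Fl _ Fa; have [x0 [x1 [-> x0g x1g]]] := gbas_split x.
rewrite /sact !(linD (act_linearl _ _)) (linD Fl).
by rewrite !(Fa _ _ _ x0g) !(Fa _ _ _ x1g) !andbF !expr0 !scale1r.
Qed.

(** Evaluation at the empty word turns homomorphisms into a coinduced module into parity-preserving
    linear maps to [M]. Such a map [h0] extends over [B] as a linear map and is converted back by
    sending b to the function w |-> h0 (w b). *)
Lemma cofree_injective (M : supermodule g) : injective_supermodule (cofree M).
Proof.
move=> A B i f ih i_inj fh.
have [[il _ _] [fl _ _]] := (ih, fh).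
pose ev (phi : cofree M) : M := subm_val phi [::].
have [h hl hi] : exists2 h : B -> M, linear h & forall a, h (i a) = ev (f a).
  by apply: linear_extension => // c u v /=; rewrite fl.
(* The parity-preserving part of [h]; it still extends [ev (f a)] because [i], [f] and [ev] preserve
   parity. *)
pose h0 b : M := \sum_(a : bool) sproj a (h (sproj a b)).
have h0E b : h0 b = sproj true (h (sproj true b)) + sproj false (h (sproj false b)).
  by rewrite /h0 big_bool.
have h0l : linear h0.
  move=> c u v; rewrite !h0E /sproj !spr_linear !hl !spr_linear scalerDr.
  by rewrite !addrA; congr (_ + _); rewrite -!addrA; congr (_ + _); rewrite addrC.
have h0i a : h0 (i a) = ev (f a).
  rewrite h0E !(even_hom_proj _ _ ih) !hi -(even_hom_proj _ _ fh) -(even_hom_proj _ _ fh).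
  have E b (phi : cofree M) : sproj b (ev (sproj b phi)) = sproj b (ev phi).
    by rewrite /ev /= addbF; apply: spr_id.
  by rewrite !E addrC; apply: spr_sum.
have h0p a b : sproj a (h0 b) = h0 (sproj a b).
  rewrite !h0E /sproj sprD !spr_proj; case: a => /=;
  by rewrite (lin0 hl) ?spr0 ?addr0 ?add0r.
have rel b : word_rel (fun w => h0 (wact (sm_struct B) w b)).
  move=> w w' j l; rewrite -(linZ h0l) -(linB h0l) (cofree_unit_subproof (sm_struct B) b).
  by rewrite (lin_sum h0l); apply: eq_bigr => r _; rewrite (linZ h0l).
have wl w := wact_linear (sm_struct B) w.
exists (fun b => mksubm (word_rel_closed _) (rel b)).
  apply: even_homP.
  - by move=> c u v; apply: cofree_ext => w; rewrite /= wl h0l.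
  - move=> a b; apply: cofree_ext => w /=; rewrite -/(sproj _ _) h0p; congr h0.
    have := congr1 (fun phi : cofree B => subm_val phi w) (cofree_unit_pr (sm_struct B) a b).
    by [].
  - move=> x b; apply: cofree_ext => w.
    rewrite /sact [in RHS]act_bas cofree_sum [LHS]/= (act_bas _ x b) (lin_sum (wl _)) (lin_sum h0l).
    apply: eq_bigr => j _; rewrite (linZ (wl _)) (linZ h0l) cofreeZ; congr (_ *: _).
    by rewrite cofree_act_gbas /= /wact foldr_rcons.
move=> a; apply: cofree_ext => w /=.
have -> : wact (sm_struct B) w (i a) = i (wact (sm_struct A) w a).
  by elim: w => //= j w ->; rewrite (even_hom_act _ _ ih).
rewrite h0i.
have -> : f (wact (sm_struct A) w a) = wact (sm_struct (cofree M)) w (f a).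
  by elim: w => //= j w <-; rewrite (even_hom_act _ _ fh).
have E u phi : subm_val (wact (sm_struct (cofree M)) w phi) u = subm_val phi (u ++ w).
  elim: w u => [|j w IH] u; first by rewrite cats0.
  by rewrite -cat_rcons -IH -(cofree_act_gbas (sm_struct M)).
by rewrite /ev E.
Qed.

(** * The cokernel of the unit of coinduction *)

Section Cokernel.
Variables (V : lmodType k) (M : smodStruct g V).
Let I := cofree_sort V.
Let IM : smodStruct g I := cofree_struct M.

(* The cokernel of the unit V -> I, realized as a complement: the kernel of the
   retraction phi |-> phi 1. *)
Fact coker_closed : subm_val (0 : I) [::] = 0 /\
  forall a (phi psi : I), subm_val phi [::] = 0 -> subm_val psi [::] = 0 ->
    subm_val (a *: phi + psi) [::] = 0.
Proof. by split=> // a phi psi E F; rewrite cofreeD cofreeZ E F scaler0 addr0. Qed.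

Definition coker_sort : lmodType k :=
  subm (P := fun phi : I => subm_val phi [::] = 0) coker_closed.

Fact coker_proj_subproof (phi : I) :
  subm_val (phi - cofree_unit M (subm_val phi [::])) [::] = 0.
Proof. by rewrite cofreeB subrr. Qed.
Definition coker_proj (phi : I) : coker_sort :=
  mksubm coker_closed (coker_proj_subproof phi).

Lemma coker_projE phi :
  (coker_proj phi : I) = phi - cofree_unit M (subm_val phi [::]).
Proof. by []. Qed.

Lemma coker_proj_linear : linear coker_proj.
Proof.
move=> a phi psi; apply: subm_inj; rewrite coker_projE.
rewrite cofreeD cofreeZ cofree_unit_linear /=.
by rewrite scalerBr opprD addrACA.
Qed.

Lemma coker_projK (c : coker_sort) : coker_proj c = c.
Proof.
apply: subm_inj; rewrite coker_projE (submP c).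
by rewrite (lin0 (cofree_unit_linear M)) subr0.
Qed.

Lemma coker_proj_unit v : coker_proj (cofree_unit M v) = 0.
Proof. by apply: subm_inj; rewrite coker_projE subrr. Qed.

Lemma coker_proj_eq0 phi : coker_proj phi = 0 -> exists v, cofree_unit M v = phi.
Proof.
move=> /(congr1 (fun c : coker_sort => c : I)); rewrite coker_projE => /eqP.
by rewrite subr_eq0 => /eqP E; exists (subm_val phi [::]).
Qed.

Lemma coker_proj_act x phi :
  coker_proj (act IM x (coker_proj phi)) = coker_proj (act IM x phi).
Proof.
rewrite coker_projE actB (linB coker_proj_linear) -cofree_unit_act.
by rewrite coker_proj_unit subr0.
Qed.

Lemma coker_proj_pr a phi :
  coker_proj (spr IM a phi) = spr IM a (coker_proj phi) :> I.
Proof.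
rewrite !coker_projE sprB; congr (_ - _).
by rewrite [RHS]cofree_unit_pr /= addbF.
Qed.

Let coker_pr_subproof a (c : coker_sort) : subm_val (spr IM a c) [::] = 0.
Proof. by have /= := submP c; rewrite addbF => ->; rewrite spr0. Qed.
Let coker_pr a (c : coker_sort) : coker_sort :=
  mksubm coker_closed (coker_pr_subproof a c).

Definition coker_struct : smodStruct g coker_sort.
Proof.
refine (@SmodStruct k g coker_sort coker_pr
  (fun x c => coker_proj (act IM x c)) _ _ _ _ _ _ _).
- by move=> a b u v; apply: subm_inj; apply: (spr_linear IM).
- move=> a b c; apply: subm_inj.
  rewrite [LHS](spr_proj IM a b (c : I)).
  by case: eqP.
- by move=> c; apply: subm_inj; apply: (spr_sum IM).
- by move=> c a x y; rewrite act_linearl coker_proj_linear.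
- by move=> x a u v; rewrite act_linearr coker_proj_linear.
- move=> a b x c xa /(congr1 (fun c : coker_sort => c : I)) cb.
  apply: subm_inj; rewrite [LHS](_ : _ = spr IM (a (+) b) (coker_proj (act IM x c))) //.
  by rewrite -coker_proj_pr (act_parity xa).
- move=> a b x y c xa yb; rewrite !coker_proj_act (act_lbr IM _ xa yb).
  by rewrite (linB coker_proj_linear) (linZ coker_proj_linear).
Defined.

End Cokernel.

Definition coker (M : supermodule g) : supermodule g :=
  Supermodule (coker_struct (sm_struct M)).

(** Each module embeds in its coinduced module; splicing the resulting short exact sequences gives
    the resolution. *)
Theorem injective_resolution_exists (M : supermodule g) :
  exists (J : nat -> supermodule g) (eta : M -> J 0%N)
         (delta : forall b, J b -> J b.+1), injective_resolution eta delta.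
Proof.
pose C b := iter b coker M.
pose unit b : C b -> cofree (C b) := @cofree_unit _ (sm_struct (C b)).
pose proj b : cofree (C b) -> C b.+1 := @coker_proj _ (sm_struct (C b)).
have unit_even b : even_hom (@unit b).
  apply: even_homP; first exact: cofree_unit_linear.
    by move=> a v; apply: cofree_unit_pr.
  by move=> x v; apply: cofree_unit_act.
have proj_even b : even_hom (@proj b).
  apply: even_homP; first exact: coker_proj_linear.
    by move=> a v; apply: subm_inj; symmetry; apply: coker_proj_pr.
  by move=> x v; symmetry; apply: coker_proj_act.
exists (fun b => cofree (C b)), (@unit 0%N), (fun b => @unit b.+1 \o @proj b).
have unit_inj b : injective (@unit b) by apply: cofree_unit_inj.
have delta0 b (w : cofree (C b)) : unit b.+1 (proj b w) = 0 <-> exists v, unit b v = w.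
  split=> [w0|[v <-]]; last first.
    by rewrite [proj _ _]coker_proj_unit; exact: (lin0 (even_hom_linear (unit_even _))).
  apply: coker_proj_eq0; apply: (unit_inj b.+1); rewrite [LHS]w0.
  by rewrite (lin0 (even_hom_linear (unit_even _))).
split=> //.
- by move=> b; apply: cofree_injective.
- exact: (unit_even 0%N).
- move=> b; apply: even_homP => /=.
  + exact: comp_linear (even_hom_linear (unit_even b.+1)) (even_hom_linear (proj_even b)).
  + by move=> a v; rewrite (even_hom_proj a _ (unit_even b.+1)) (even_hom_proj a _ (proj_even b)).
  + by move=> x v; rewrite (even_hom_act x _ (proj_even b)) (even_hom_act x _ (unit_even b.+1)).
- exact: delta0.
- move=> b w; split=> [/delta0[v <-]|[u <-]]; last by apply/delta0; eexists.
  (* [v] belongs to a cokernel realised inside [cofree (C b)], so its underlying element is a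
     preimage of it under the projection. *)
  by exists (subm_val v); rewrite /= [proj _ _](@coker_projK _ (sm_struct (C b)) v).
Qed.

End SupermoduleTheory.

(** * Evaluation at a point *)

Section Evaluation.
Variables (k : fieldType) (g : lieSuperalgebra k) (x : g) (N : nat).
Hypotheses (x_odd : x \in lpart g true) (xx0 : lbr x x = 0).
Local Notation d := (sdim g true).
Local Notation B := 'X_{1..d < N}.
Implicit Types (W : lmodType k) (m : 'X_{1..d}) (i r : gen g).

Definition pt (j : 'I_d) : k := gdual (inr j) x.
Definition ptmon m : k := \prod_(j < d) pt j ^+ m j.

Lemma ptmonDU m j : ptmon (m + U_(j)) = pt j * ptmon m.
Proof.
rewrite /ptmon (bigD1 j) //= [in RHS](bigD1 j) //= mulrA; congr (_ * _).
  by rewrite mnmDE mnm1E eqxx addn1 exprS.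
by apply: eq_bigr => l Nl; rewrite mnmDE mnm1E eq_sym (negPf Nl) addn0.
Qed.

(* The substitution xi_i = 0 for i even, y_j = y_j(x), in degree n. *)
Definition ev W n (c : cochain g W) : W :=
  \sum_(m : B | mdeg m == n) ptmon m *: c set0 m.

Lemma ev_linear W n : linear (@ev W n).
Proof.
move=> a c e; rewrite /ev scaler_sumr -big_split; apply: eq_bigr => m _ /=.
by rewrite scalerDr !scalerA mulrC.
Qed.

Lemma eq_ev W n (c e : cochain g W) :
  (forall S m, mono_deg S m = n -> c S m = e S m) -> ev n c = ev n e.
Proof.
move=> ce; apply: eq_bigr => m /eqP Dm; rewrite ce //.
by rewrite /mono_deg cards0 Dm.
Qed.

Lemma ev_comp W W' n (F : W -> W') (c : cochain g W) : linear F ->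
  ev n (fun S m => F (c S m)) = F (ev n c).
Proof.
by move=> Fl; rewrite (lin_sum Fl); apply: eq_bigr => m _; rewrite (linZ Fl).
Qed.

Lemma ev_sum W n I (s : seq I) (c : I -> cochain g W) :
  ev n (fun S m => \sum_(i <- s) c i S m) = \sum_(i <- s) ev n (c i).
Proof. by rewrite exchange_big; apply: eq_bigr => m _; rewrite scaler_sumr. Qed.

Lemma ev_shift W n j (F : 'X_{1..d} -> W) : (n.+1 < N)%N ->
  ev n.+1 (fun _ m => if (0 < m j)%N then F (m - U_(j))%MM else 0)
  = pt j *: ev n (fun _ m => F m).
Proof.
move=> nN; rewrite /ev.
(* The default value of [insubd] matters only where the shifted monomial leaves the bound, which
   cannot happen in degree n. *)
pose up (m : B) : B := insubd m (m + U_(j))%MM.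
pose down (m : B) : B := insubd m (m - U_(j))%MM.
have downE (m : B) : down m = (m - U_(j))%MM :> 'X_{1..d}.
  by rewrite val_insubd ifT //; apply: leq_ltn_trans (mdegB _ _) (bmdeg m).
have upE (m : B) : mdeg m == n -> up m = (m + U_(j))%MM :> 'X_{1..d}.
  by move=> /eqP Dm; rewrite val_insubd ifT // mdegD mdeg1 Dm addn1.
rewrite (bigID (fun m : B => (0 < m j)%N)) /= addrC big1 ?add0r; last first.
  by move=> m /andP[_ /negPf ->]; rewrite scaler0.
rewrite [in RHS](reindex_onto down up) /=; last first.
  by move=> m Dm; apply: val_inj; rewrite /= downE upE // addmK.
have mK (m : B) : (0 < m j)%N -> (m - U_(j) + U_(j))%MM = m.
  by move=> m0; rewrite submK // lep1mP -lt0n.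
rewrite scaler_sumr; apply: eq_big => [m|m /andP[_ m0]]; last first.
  by rewrite m0 downE scalerA -ptmonDU mK.
apply/andP/andP => [[/eqP Dm m0]|[Dm /eqP Em]].
  have Ddown : mdeg (down m) == n.
    by rewrite downE -(eqn_add2r 1) -(mdeg1 j) -mdegD mK ?Dm ?mdeg1 ?addn1.
  by split=> //; apply/eqP/val_inj; rewrite /= upE // downE mK.
have Em' : (down m + U_(j))%MM = m by rewrite -(upE _ Dm) Em.
rewrite -Em' mdegD mdeg1 addn1 eqSS Dm; split=> //.
by rewrite mnmDE mnm1E eqxx addn1.
Qed.

Definition ev1 W n (c : cochain g W) : W := if n is n'.+1 then ev n' c else 0.

Lemma gdual_even (l : 'I_(sdim g false)) : gdual (inl l) x = 0.
Proof. exact: (@gdual_par _ _ (inl l) _ _ x_odd). Qed.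

Lemma ev_mulgen W n i (c : cochain g W) : (n < N)%N ->
  ev n (mulgen i c) = gdual i x *: ev1 n c.
Proof.
case: i => l nN.
  rewrite gdual_even scale0r /ev big1 // => m _.
  by rewrite /mulgen inE scaler0.
case: n nN => [|n] nN /=.
  rewrite scaler0 /ev big1 // => m; rewrite mdeg_eq0 => /eqP ->.
  by rewrite /mulgen mnm0E scaler0.
transitivity (ev n.+1 (fun (_ : mono0 g) m =>
    if (0 < m l)%N then c set0 (m - U_(l))%MM else 0)); last exact: ev_shift.
by apply: eq_bigr => m _; rewrite /mulgen cards0 expr0 scale1r.
Qed.

Lemma ev1_mulgen W n i (c : cochain g W) : (n < N)%N ->
  ev1 n (mulgen i c) = gdual i x *: ev1 n.-1 c.
Proof.
case: n => [|n] nN /=; first by rewrite scaler0.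
by rewrite ev_mulgen // ltnW.
Qed.

Lemma sum_strc r : \sum_i \sum_j (gdual i x * gdual j x) * strc i j r = 0.
Proof. by rewrite -gdual_lbr xx0 (lin0 (@gdual_linear _ _ r)). Qed.

Lemma gdual_ksign i j : gdual i x * gdual j x * ksign i j = - (gdual i x * gdual j x).
Proof.
case: i => l; first by rewrite gdual_even !mul0r oppr0.
case: j => l'; first by rewrite gdual_even mulr0 mul0r oppr0.
by rewrite /ksign /= mulrN1.
Qed.

Lemma evZ W n a (c : cochain g W) : ev n (fun S m => a *: c S m) = a *: ev n c.
Proof. exact: (linZ (@ev_linear W n)). Qed.

(** After evaluation each d(xi_r) becomes a multiple of xi_r([x, x]), which is 0. *)
Lemma ev_kdiff W n (c : cochain g W) : (n < N)%N -> ev n (kdiff c) = 0.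
Proof.
move=> nN; rewrite /kdiff evZ ev_sum.
rewrite (eq_bigr (fun i => \sum_j \sum_r
    (- (gdual i x * gdual j x * strc i j r)) *: ev1 n.-1 (dergen r c))); last first.
  move=> i _; rewrite ev_sum; apply: eq_bigr => j _; rewrite ev_sum.
  apply: eq_bigr => r _; rewrite evZ ev_mulgen // ev1_mulgen //.
  rewrite !scalerA -/(ksign i j) -/(strc i j r); congr (_ *: _).
  by rewrite -[in RHS]mulNr -gdual_ksign; ring.
under eq_bigr => i _ do rewrite exchange_big.
rewrite exchange_big big1 ?scaler0 // => r _.
under eq_bigr => i _ do rewrite -scaler_suml.
rewrite -scaler_suml; under eq_bigr => i _ do rewrite sumrN.
by rewrite sumrN sum_strc oppr0 scale0r.
Qed.

Section Modules.
Variables (M : supermodule g).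
Implicit Types (J : supermodule g).

(** The supercommutator with the odd element x; [hom_twist] supplies the sign (-1)^|F|. *)
Definition adx J (F : M -> J) (v : M) : J := sact x (F v) - hom_twist F (sact x v).

Lemma hom_twist_linear J (F : M -> J) : linear F -> linear (hom_twist F).
Proof.
move=> Fl a u v; rewrite /hom_twist /sproj !spr_linear.
set p := spr _ false u; set q := spr _ true u.
set r := spr _ false v; set s := spr _ true v.
rewrite opprD addrACA -scalerBr Fl !spr_linear opprD addrACA.
by rewrite -scalerBr.
Qed.

Lemma adx_linear J (F : M -> J) : linear F -> linear (adx F).
Proof.
move=> Fl a u v; rewrite /adx Fl /sact !act_linearr hom_twist_linear //.
by rewrite scalerBr opprD addrACA.
Qed.

Lemma ev_hom_act J n i (c : cochain g (M -> J)) v :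
  ev n (fun S m => hom_act i (c S m) v)
  = hom_act i (fun u => ev n (fun S m => c S m u)) v.
Proof.
pose sg (L : supermodule g) (u : L) := sproj false u - sproj true u.
have sgl L : linear (@sg L).
  by move=> a u w; rewrite /sg /sproj !spr_linear opprD addrACA scalerBr.
rewrite /hom_act (linB (@ev_linear J n)); congr (_ - _).
  exact/ev_comp/act_linearr.
by case: (gpar i) => //; apply: (ev_comp _ _ (sgl J)).
Qed.

(** The Koszul part evaluates to 0. Among the terms xi_i (x) e_i F only odd generators survive,
    weighted by xi_i(x), and these weights reassemble x from the basis. *)
Lemma ev_hom_kdiff J n (c : cochain g (M -> J)) v : (n.+1 < N)%N ->
  (forall S m, linear (c S m)) ->
  ev n.+1 (fun S m => hom_kdiff c S m v)
  = - ((-1) ^+ odd n *: adx (fun u => ev n (fun S m => c S m u)) v).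
Proof.
move=> nN cl; set F := (X in adx X).
have Fl : linear F by move=> a u w; rewrite /F -ev_linear; apply: eq_bigr => m _; rewrite cl.
rewrite /hom_kdiff (linB (@ev_linear J n.+1)) ev_kdiff // sub0r ev_sum; congr (- _).
rewrite {1}/adx /sact (act_bas _ x (F v)) (act_bas _ x v).
rewrite (lin_sum (hom_twist_linear Fl)) -sumrB scaler_sumr.
apply: eq_bigr => -[l|l] _; first by rewrite ev_mulgen // gdual_even !scale0r
  (lin0 (hom_twist_linear Fl)) subr0 scaler0.
rewrite ev_mulgen // (linZ (hom_twist_linear Fl)) -scalerBr scalerA mulrC -scalerA.
congr (_ *: _) => /=; rewrite -[in RHS]/(hom_act (inr l) F v) -ev_hom_act -evZ.
by apply: eq_bigr => m /eqP Dm; rewrite Dm.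
Qed.

Lemma adx_comp J J' (F : M -> J) (G : J -> J') v :
  even_hom G -> adx (G \o F) v = G (adx F v).
Proof.
move=> Gh; rewrite /adx /hom_twist /= (linB (even_hom_linear Gh)).
by rewrite !(even_hom_proj _ _ Gh) -(linB (even_hom_linear Gh)) (even_hom_act _ _ Gh).
Qed.

Hypothesis two_neq0 : 2%:R != 0 :> k.

Lemma act_sqr0 J (v : J) : sact x (sact x v) = 0.
Proof.
have := act_lbr (sm_struct J) v x_odd x_odd.
rewrite xx0 act0l expr1 scaleN1r opprK -/(sact _ _) -mulr2n -scaler_nat.
by move/esym/eqP; rewrite scaler_eq0 (negPf two_neq0) => /eqP.
Qed.

Lemma sproj_act_odd J a (v : J) : sproj a (sact x v) = sact x (sproj (~~ a) v).
Proof. by rewrite /sproj /sact (spr_act _ _ _ x_odd) addbT. Qed.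

Definition psgn (L : supermodule g) (u : L) : L := sproj false u - sproj true u.

Lemma hom_twistE (L J : supermodule g) (F : L -> J) v : hom_twist F v = psgn (F (psgn v)).
Proof. by []. Qed.

Lemma psgn_linear (L : supermodule g) : linear (@psgn L).
Proof. by move=> a u v; rewrite /psgn /sproj !spr_linear opprD addrACA -scalerBr. Qed.

Lemma psgn_act (L : supermodule g) (v : L) : psgn (sact x v) = - sact x (psgn v).
Proof. by rewrite /psgn !sproj_act_odd /= /sact actB opprB. Qed.

Lemma adxP J c (F G : M -> J) v :
  adx (fun u => c *: F u + G u) v = c *: adx F v + adx G v.
Proof.
rewrite /adx !hom_twistE /sact act_linearr psgn_linear.
by rewrite scalerBr opprD addrACA.
Qed.

Lemma eq_adx J (F G : M -> J) v : F =1 G -> adx F v = adx G v.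
Proof. by move=> FG; rewrite /adx /hom_twist !FG. Qed.

Lemma adx0 J v : adx (fun _ => 0 : J) v = 0.
Proof. by rewrite /adx /hom_twist /sact act0 /sproj !spr0 !subrr. Qed.

Lemma adxZ J c (F : M -> J) v : adx (fun u => c *: F u) v = c *: adx F v.
Proof.
rewrite -[RHS]addr0 -[X in _ + X](adx0 J v) -adxP.
by apply: eq_adx => u; rewrite addr0.
Qed.

Lemma ghom_linear J (F : M -> J) : ghom F -> linear F.
Proof.
case=> F0 [F1 [[l0 _ _] [l1 _ _] FE]] a u v; rewrite !FE l0 l1.
by rewrite scalerDr addrACA.
Qed.

Lemma adx_adx J (F : M -> J) v : linear F -> adx (adx F) v = 0.
Proof.
move=> Fl.
have sactN (L : supermodule g) (u : L) : sact x (- u) = - sact x u by apply: actN.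
have sactB (L : supermodule g) (u w : L) : sact x (u - w) = sact x u - sact x w.
  exact: actB.
have psgn0 L : @psgn L 0 = 0 := lin0 (@psgn_linear L).
have E w : sact x w = 0 -> adx F w = sact x (F w).
  by move=> xw; rewrite /adx xw hom_twistE psgn0 (lin0 Fl) psgn0 subr0.
rewrite {1}/adx hom_twistE (E (psgn _)); last first.
  by rewrite psgn_act sactN act_sqr0 oppr0.
by rewrite /adx sactB act_sqr0 sub0r psgn_act opprK -hom_twistE addNr.
Qed.

Lemma psgn_hom (L : supermodule g) a (w : L) :
  sproj a w = w -> psgn w = (-1) ^+ a *: w.
Proof.
move=> wa; rewrite -{1}wa /psgn /sproj !spr_proj.
by case: a wa => /= wa; rewrite /sproj in wa; rewrite wa ?sub0r ?subr0 ?scaleN1r ?scale1r.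
Qed.

(** Homomorphisms over U(g) supercommute with x. Hence the cochain bounding a class in Hom_{U(g)}(M,
    J) can be subtracted without changing [adx]. *)
Lemma adx_ghom J (F : M -> J) v : ghom F -> adx F v = 0.
Proof.
case=> F0 [F1 [[l0 p0 a0] [l1 p1 a1] FE]].
have E (G : M -> J) b : (forall a v, sproj a v = v -> sproj (b (+) a) (G v) = G v) ->
    linear G -> forall v, hom_twist G v = (-1) ^+ b *: G v.
  move=> Gp Gl u; rewrite hom_twistE [X in G X]/psgn (linB Gl).
  have H a := psgn_hom (Gp a _ (spr_id (sm_struct M) a u)).
  rewrite (linB (@psgn_linear J)) !H -[in RHS](spr_sum (sm_struct M) u) (linD Gl).
  by rewrite scalerDr addbF addbT signrN scaleNr opprK.
rewrite /adx FE.
have -> : hom_twist F (sact x v) = hom_twist F0 (sact x v) + hom_twist F1 (sact x v).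
  by rewrite !hom_twistE FE (linD (@psgn_linear J)).
rewrite (E _ _ p0 l0) (E _ _ p1 l1) (a0 _ _ _ x_odd) (a1 _ _ _ x_odd).
by rewrite /= expr0 expr1 !scale1r !scaleN1r opprK /sact actD subrr.
Qed.

End Modules.

Section Descent.
Variables (V : vectType k) (MS : smodStruct g V) (J : nat -> supermodule g).
Let M := Supermodule MS.
Variables (eta : M -> J 0%N) (delta : forall b, J b -> J b.+1).
Hypotheses (res : injective_resolution eta delta) (two_neq0 : 2%:R != 0 :> k).

Let delta_lin b : linear (@delta b) := even_hom_linear (ires_delta res b).

(* With coefficients evaluated at x, each t b is ad x of a lift h b; exactness
   of J lets one correct the h b from b = n - 1 down to b = 0 so that
   delta (h b) = 0. *)
Lemma tensor_class_ev n (a : superext g) (z : M -> J n) : (n < N)%N ->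
  tensor_class eta delta a z -> ext_coboundary delta z ->
  exists2 W : M -> M, linear W &
    forall v, ev n (fun S m => (a S)@_m *: v) = adx W v.
Proof.
move=> nN [t [h [t0 th zE]]] zcob.
pose T b v := ev (n - b)%N (fun S m => t b S m v).
pose H b v := ev (n - b.+1)%N (fun S m => h b S m v).
have Hl b : (b < n)%N -> linear (H b).
  move=> bn u v w; have [hl _ _] := th b bn.
  by rewrite /H -ev_linear; apply: eq_bigr => m _; rewrite hl.
have TH b v : (b < n)%N -> T b v = - ((-1) ^+ odd (n - b.+1)%N *: adx (H b) v).
  move=> bn; have [hl hk _] := th b bn.
  have E : (n - b = (n - b.+1).+1)%N by rewrite subnSK.
  rewrite -ev_hom_kdiff //; last by rewrite -E (leq_ltn_trans _ nN) ?leq_subr.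
  by rewrite -E; apply: eq_ev => S m Sm; rewrite hk.
have Tdelta b v : (b < n)%N -> T b.+1 v = delta (H b v).
  move=> bn; have [_ _ hd] := th b bn.
  rewrite /H -(ev_comp _ _ (@delta_lin b)); apply: eq_ev => S m Sm.
  by rewrite hd.
have etal := even_hom_linear (ires_eta res).
have T0 v : T 0%N v = eta (ev n (fun S m => (a S)@_m *: v)).
  by rewrite -(ev_comp _ _ etal) /T subn0; apply: eq_ev => S m Sm; apply: t0.
have Ttop v : T n v = z v.
  have d0N : (mdeg (0 : 'X_{1..d})%MM < N)%N.
    by rewrite mdeg0 (leq_ltn_trans (leq0n n) nN).
  rewrite zE /T subnn /ev (big_pred1 (BMultinom d0N)).
    by rewrite /= /ptmon big1 ?scale1r // => j _; rewrite mnm0E expr0.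
  by move=> m; rewrite /= mdeg_eq0.
suff [W Wl TW] : exists2 W : M -> M, linear W & forall v, T 0%N v = eta (adx W v).
  by exists W => // v; apply: (ires_eta_inj res); rewrite -T0 TW.
case: n z nN t0 th zE zcob @T @H Hl TH Tdelta T0 Ttop =>
    [|n] z nN t0 th zE zcob T H Hl TH Tdelta T0 Ttop.
  exists (fun=> 0) => [c u v|v]; first by rewrite scaler0 addr0.
  by rewrite adx0 (lin0 etal) Ttop zcob.
(* [s] is a correction invisible to [adx]; afterwards [H b - s] is closed and lifts one step down
   the resolution. *)
pose corrected b := exists s : M -> J b,
  [/\ linear s, forall v, adx s v = 0 & forall v, delta (H b v - s v) = 0].
have step b (s : M -> J b) : (b < n.+1)%N -> linear s ->
    (forall v, adx s v = 0) ->
    exists2 sg : k, True & forall v, T b v = sg *: adx (fun u => H b u - s u) v.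
  move=> bn sl s0; exists (- (-1) ^+ odd (n.+1 - b.+1)%N) => // v.
  rewrite TH // -scaleNr; congr (_ *: _).
  have E : (fun u => H b u - s u) =1 (fun u => (-1) *: s u + H b u).
    by move=> u; rewrite scaleN1r addrC.
  by rewrite (eq_adx v E) adxP s0 scaler0 add0r.
have [s [sl s0 sd]] : corrected 0%N.
  suff: forall i : nat, (i <= n)%N -> corrected (n - i)%N.
    by move/(_ n (leqnn n)); rewrite subnn.
  elim=> [_|i IH lt_in].
    (* At the top the correction is the homomorphism whose image under [delta] is [z]. *)
    rewrite subn0; have [s sh sz] := zcob; exists s; split.
    - exact: ghom_linear.
    - by move=> v; apply: adx_ghom.
    - by move=> v; rewrite (linB (@delta_lin n)) -Tdelta // Ttop sz subrr.
  have := IH (ltnW lt_in).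
  have -> : (n - i = (n - i.+1).+1)%N by rewrite subnSK.
  set b := (n - i.+1)%N; have bn : (b.+1 < n.+1)%N by rewrite /b subnSK // ltnS leq_subr.
  move=> [s [sl s0 sd]].
  have Gl : linear (fun v => H b.+1 v - s v).
    by move=> c u v; rewrite Hl // sl scalerBr opprD addrACA.
  have [W Wl WE] : exists2 W : M -> J b,
      linear W & forall v, delta (W v) = H b.+1 v - s v.
    exact: linear_lift Gl (@delta_lin b) (fun v => (ires_exact res _).1 (sd v)).
  have [sg _ TE] := step _ s bn sl s0.
  (* The next correction is itself of the form ad x (W), so ad x kills it. *)
  exists (fun v => sg *: adx W v); split.
  - move=> c u v; rewrite (adx_linear Wl).
    by rewrite scalerDr !scalerA mulrC.
  - by move=> v; rewrite adxZ adx_adx // scaler0.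
  - move=> v; rewrite (linB (@delta_lin b)) -Tdelta ?(ltnW bn) // TE.
    rewrite (linZ (@delta_lin b)) -(adx_comp _ _ (ires_delta res b)).
    by rewrite (eq_adx _ (fun u => esym (WE u))) subrr.
have Gl : linear (fun v => H 0%N v - s v).
  by move=> c u v; rewrite Hl // sl scalerBr opprD addrACA.
have [W Wl WE] : exists2 W : M -> M,
    linear W & forall v, eta (W v) = H 0%N v - s v.
  exact: linear_lift Gl etal (fun v => (ires_exact0 res _).1 (sd v)).
have [sg _ TE] := step _ s (ltn0Sn n) sl s0.
exists (fun v => sg *: W v) => [c u v|v].
  by rewrite Wl scalerDr !scalerA mulrC.
rewrite TE adxZ (linZ etal) -(adx_comp _ _ (ires_eta res)).
by rewrite (eq_adx _ (fun u => esym (WE u))).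
Qed.
End Descent.
End Evaluation.

(** The annihilator condition concerns one degree at a time, so each homogeneous component of f^p
    yields its own homotopy; their sum serves for the value of f^p at x. *)
Lemma J_ideal_homotopy (k : fieldType) (g : lieSuperalgebra k) (V : vectType k)
    (MS : smodStruct g V) p (f : {mpoly k[sdim g true]}) x :
  x \in lpart g true -> lbr x x = 0 -> 2%:R != 0 :> k ->
  J_ideal p (Supermodule MS) f ->
  exists2 W : V -> V, linear W &
    forall v, f.@[pt x] ^+ p *: v = adx x (W : Supermodule MS -> Supermodule MS) v.
Proof.
move=> x_odd xx0 two [_ [J [eta [delta [res cl]]]]].
pose M := Supermodule MS; pose N := (msize (f ^+ p)).+1.
pose e n : k := \sum_(m : bmultinom (sdim g true) N | mdeg m == n)
  (f ^+ p)@_m * ptmon x m.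
(* The guard [n \in gtn N] sits inside the existential so that [choice] applies to all n at once. *)
have ex n : exists W : M -> M, n \in gtn N ->
    linear W /\ forall v, e n *: v = adx x W v.
  have [nN|nN] := boolP (n \in gtn N); last by exists id.
  have [z tz cz] := cl n.
  have [W Wl WE] := tensor_class_ev x_odd xx0 res two nN tz cz.
  exists W => _; split=> // v; rewrite -WE scaler_suml; apply: eq_bigr => m _.
  by rewrite /phi eqxx scalerA mulrC.
have [W WP] := choice ex.
exists (\sum_(n < N) W n : V -> V).
  move=> c u v; elim/big_ind: _ => [|F G|n _].
  - by rewrite scaler0 addr0.
  - by move=> FE GE; rewrite !fctE FE GE scalerDr addrACA.
  - by have [Wl _] := WP n (ltn_ord n); exact: Wl.
move=> v; have adl : linear (fun F : M -> M => adx x F v).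
  by move=> c F G; apply: adxP.
rewrite (lin_sum adl) -rmorphXn [in LHS](mpolywE (leqnSn (msize (f ^+ p)))).
rewrite rmorph_sum /= (partition_big (fun m : bmultinom (sdim g true) N =>
  Ordinal (bmdeg m)) xpredT) //= scaler_suml.
apply: eq_bigr => n _; have [_ <-] := WP n (ltn_ord n); congr (_ *: _).
apply: eq_big => [m|m _]; first by rewrite -val_eqE.
by rewrite mevalZ mevalX.
Qed.

(** * Freeness over an odd element of square zero *)

Section Freeness.
Variables (k : fieldType) (g : lieSuperalgebra k) (V : vectType k).
Variables (MS : smodStruct g V) (x : g).
Hypotheses (x_odd : x \in lpart g true) (xx0 : lbr x x = 0).
Hypothesis two_neq0 : 2%:R != 0 :> k.
Let M := Supermodule MS.
Let X (v : M) : M := sact x v.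
Let X_lin : linear X := act_linearr MS x.
Let sg (v : M) : M := psgn v.
Let sg_lin : linear sg := @psgn_linear k g M.

Definition contractible : Prop := exists s : V -> V,
  [/\ linear s, forall a v, spr MS a (s v) = s (spr MS (~~ a) v)
    & forall v, act MS x (s v) + s (act MS x v) = v].

Let sgK v : sg (sg v) = v.
Proof.
rewrite /sg /psgn /sproj !sprB !spr_proj /= subr0 sub0r opprK.
exact: (spr_sum MS).
Qed.

Let sgX v : sg (X v) = - X (sg v).
Proof. exact: psgn_act. Qed.

(** [W - sg W sg] is twice the odd part of [W], so a homotopy that is not homogeneous may be
    replaced by an odd one at the cost of a factor 2. *)
Let contractible_odd_part (W : M -> M) c : linear W -> c != 0 ->
  (forall v, X (W v - sg (W (sg v))) + (W (X v) - sg (W (sg (X v)))) = c *: v) ->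
  contractible.
Proof.
move=> Wl c0 H; pose O v := W v - sg (W (sg v)).
have Ol : linear O.
  by move=> a u v; rewrite /O Wl sg_lin Wl sg_lin scalerBr opprD addrACA.
have Osg v : sg (O v) = - O (sg v).
  by rewrite /O (linB sg_lin) !sgK opprB.
have sprE a (v : V) : 2%:R *: spr MS a v = v + (-1) ^+ a *: sg v.
  have -> : sg v = spr MS false v - spr MS true v by [].
  rewrite -{2}(spr_sum MS v) scaler_nat mulr2n; case: a.
    rewrite expr1 scaleN1r opprB (addrC (spr MS false v)) addrACA subrr addr0.
    by [].
  by rewrite expr0 scale1r addrACA subrr addr0.
exists (fun v => c^-1 *: O v); split=> [a u v|a v|v].
- by rewrite Ol scalerDr !scalerA mulrC.
- rewrite sprZ; congr (_ *: _); apply: (scalerI two_neq0).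
  by rewrite -(linZ Ol) !sprE (linD Ol) (linZ Ol) Osg; case: a; rewrite /= ?scaleN1r ?scale1r ?opprK.
- by rewrite actZ -scalerDr [X in _ *: X]H scalerA mulVf // scale1r.
Qed.

(** Conjugating c = x W - sg W sg x by the parity automorphism gives c = W x - x sg W sg. The sum of
    the two says that x and [W - sg W sg] have anticommutator 2c. *)
Lemma adx_contractible (W : M -> M) c : linear W -> c != 0 ->
  (forall v, c *: v = adx x W v) -> contractible.
Proof.
move=> Wl c0 H; apply: (contractible_odd_part (c := 2%:R * c) Wl).
  by rewrite mulf_neq0.
have E v : X (W v) - sg (W (sg (X v))) = c *: v by rewrite H.
have E' v : X (sg (W (sg v))) = W (X v) - c *: v.
  apply: (can_inj sgK); rewrite sgX sgK (linB sg_lin) (linZ sg_lin).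
  have := E (sg v); rewrite sgX sgK (linN Wl) (linN sg_lin) opprK => <-.
  by rewrite opprD addrCA subrr addr0.
move=> v; rewrite (linB X_lin) E' opprB.
have -> : X (W v) = c *: v + sg (W (sg (X v))) by rewrite -E addrNK.
move: (sg (W (sg (X v)))) (W (X v)) => A B.
rewrite (addrACA (c *: v)) -!addrA addKr subrr addr0.
by rewrite -scalerA scaler_nat mulr2n.
Qed.

Let X_sqr0 v : X (X v) = 0. Proof. exact: act_sqr0. Qed.

Lemma free_contractible : x != 0 -> free_over MS x -> contractible.
Proof.
move=> x0 [B Bhom]; rewrite (negPf x0) => bB.
set L := B ++ _ in bB; pose b := in_tuple L.
have bb : basis_of {:V} b by [].
have szL : size L = (size B + size B)%N by rewrite size_cat size_map.
have lt2 (i : 'I_(size B)) : (size B + i < size L)%N by rewrite szL ltn_add2l.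
(* The linear map that kills [B] and sends each x b back to b. *)
pose s v := \sum_(i < size B) coord b (Ordinal (lt2 i)) v *: B`_i.
have sl : linear s.
  move=> a u v; rewrite scaler_sumr -big_split; apply: eq_bigr => i _ /=.
  by rewrite linearP scalerDl scalerA.
have sb (j : 'I_(size L)) : s L`_j =
    \sum_(i < size B) ((size B + i)%N == j)%:R *: B`_i.
  apply: eq_bigr => i _; rewrite (coord_free _ _ (basis_free bb)).
  by rewrite eq_sym.
have LB (i : 'I_(size B)) : L`_i = B`_i by rewrite nth_cat ltn_ord.
have LX (i : 'I_(size B)) : L`_(size B + i) = X B`_i.
  by rewrite nth_cat ltnNge leq_addr addKn (nth_map 0).
have sB (i : 'I_(size B)) : s B`_i = 0.
  have lti : (i < size L)%N by rewrite szL ltn_addr.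
  rewrite -LB (sb (Ordinal lti)) big1 // => j _; rewrite /=.
  by rewrite gtn_eqF ?scale0r // ltn_addr.
have sX (i : 'I_(size B)) : s (X B`_i) = B`_i.
  rewrite -LX (sb (Ordinal (lt2 i))) (bigD1 i) //= eqxx scale1r big1 ?addr0 // => j ji.
  by rewrite eqn_add2l val_eqE (negPf ji) scale0r.
have sXE v : X (s v) + s (X v) = v.
  have Fl : linear (fun v => X (s v) + s (X v)).
    by move=> c u w; rewrite sl X_lin X_lin sl scalerDr addrACA.
  rewrite [in LHS](coord_basis bb (memvf v)) [RHS](coord_basis bb (memvf v)).
  rewrite (lin_sum Fl); apply: eq_bigr => i _; rewrite (linZ Fl); congr (_ *: _).
  have [iB|Bi] := ltnP i (size B).
    have -> : b`_i = B`_(Ordinal iB) by rewrite -LB.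
    by rewrite sB sX (lin0 X_lin) add0r.
  have lti : (i - size B < size B)%N by rewrite ltn_subLR // -szL.
  have -> : b`_i = X B`_(Ordinal lti) by rewrite -LX /= subnKC.
  by rewrite sX X_sqr0 (lin0 sl) addr0.
apply: (contractible_odd_part (W := s) (c := 2%:R)) => // v.
have E : sg (X (s (sg v)) + s (X (sg v))) = v by rewrite sXE sgK.
rewrite (linD sg_lin) sgX in E.
have E' : X (s v) = v - s (X v) by rewrite -{2}(sXE v) addrK.
rewrite (linB X_lin) E' sgX (linN sl) (linN sg_lin) opprK.
have -> : X (sg (s (sg v))) = sg (s (X (sg v))) - v 
  by move: E; move: (X _) (sg _) => P C <-; rewrite opprD opprK addrCA subrr addr0.
move: (sg (s (X (sg v)))) (s (X v)) => C D.
by rewrite opprB addrACA !addrNK scaler_nat mulr2n.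
Qed.

(** On ker x one has x s = 1. So applying s to a homogeneous basis of ker x gives a set B for which
    x B is that basis again, and v = x (s v) + s (x v) shows that B and x B span. Their number is at
    most dim ker x + dim im x, since ker x lies in im x. *)
Lemma contractible_free : x != 0 -> contractible -> free_over MS x.
Proof.
move=> x0 [s [sl sp sX]].
pose Xl := GRing.isLinear.Build k V V *:%R (act MS x) X_lin.
pose Xf : {linear V -> V} := HB.pack (act MS x) Xl.
pose prl a := GRing.isLinear.Build k V V *:%R (spr MS a) (spr_linear MS a).
pose prf a : {linear V -> V} := HB.pack (spr MS a) (prl a).
pose Z a := (lker (linfun Xf) :&: limg (linfun (prf a)))%VS.
have ZP a v : reflect (act MS x v = 0 /\ spr MS a v = v) (v \in Z a).
  rewrite memv_cap memv_ker (lfunE Xf) /=; apply: (iffP andP).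
    move=> [/eqP -> /memv_imgP[u _]]; rewrite (lfunE (prf a)) => ->.
    by rewrite spr_id.
  move=> [-> va]; split=> //; apply/memv_imgP; exists v; rewrite ?memvf //.
  by rewrite (lfunE (prf a)).
pose B := [seq s z | z <- vbasis (Z false) ++ vbasis (Z true)].
exists B => [v|].
  have H a z : z \in vbasis (Z a) -> spr MS (~~ a) (s z) = s z.
    by move=> /vbasis_mem/ZP[_ za]; rewrite sp negbK za.
  by case/mapP => z; rewrite mem_cat => /orP[] /H Hz ->; [exists true|exists false].
rewrite (negPf x0); set XB := [seq _ | _ <- B].
have spanL (h : V -> V) a (S : seq V) z : linear h ->
    {subset [seq h w | w <- vbasis (Z a)] <= S} -> z \in Z a -> h z \in <<S>>%VS.
  move=> hl sub zZ; rewrite (coord_vbasis zZ) (lin_sum hl); apply: memv_suml => i _.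
  rewrite (linZ hl); apply/memvZ/memv_span/sub/map_f.
  by rewrite mem_nth ?size_tuple.
have kerZ v : act MS x v = 0 -> forall a, spr MS a v \in Z a.
  by move=> v0 a; apply/ZP; rewrite spr_id; split=> //;
     have := spr_act MS (~~ a) v x_odd; rewrite v0 spr0 addbT negbK.
have in_span (h : V -> V) v : linear h -> act MS x v = 0 ->
    {subset [seq h w | w <- vbasis (Z false) ++ vbasis (Z true)] <= B ++ XB} ->
    h v \in <<B ++ XB>>%VS.
  move=> hl v0 sub; rewrite -(spr_sum MS v) (linD hl).
  have sub' a : {subset [seq h w | w <- vbasis (Z a)] <= B ++ XB}.
    move=> _ /mapP[w wZ ->]; apply/sub/map_f; rewrite mem_cat.
    by case: a wZ => ->; rewrite ?orbT.
  by apply: memvD; apply: (spanL _ _ _ _ hl (sub' _)); apply: kerZ.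
rewrite basisEdim; apply/andP; split.
  apply/subvP => v _; rewrite -(sX v); apply: memvD.
    have {1}-> : act MS x (s v) = act MS x (s (act MS x (s v))).
      by rewrite -{1}[act MS x (s v)]sX [act MS x (act MS x _)]X_sqr0 (lin0 sl) addr0.
    apply: (in_span (fun w => act MS x (s w))).
    - by move=> c u w; rewrite sl act_linearr.
    - exact: X_sqr0.
    - by move=> w; rewrite mem_cat /XB /B -map_comp => ->; rewrite orbT.
  apply: (in_span s) => //.
  by move=> w wB; rewrite mem_cat wB.
have Zdisj : (Z false :&: Z true = 0)%VS.
  apply/eqP; rewrite -subv0; apply/subvP => v; rewrite memv_cap => /andP[/ZP[_ vf] /ZP[_ vt]].
  by rewrite memv0 -vt (spr_neq vf).
have szB : size B = \dim (Z false + Z true).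
  by rewrite size_map size_cat !size_tuple dimv_disjoint_sum.
have le_ker : (size B <= \dim (lker (linfun Xf)))%N.
  by rewrite szB dimvS // subv_add !capvSl.
have le_img : (\dim (lker (linfun Xf)) <= \dim (limg (linfun Xf)))%N.
  apply/dimvS/subvP => v; rewrite memv_ker (lfunE Xf) /= => /eqP v0.
  apply/memv_imgP; exists (s v); rewrite ?memvf // (lfunE Xf) /=.
  by rewrite -{1}(sX v) v0 (lin0 sl) addr0.
have -> : size (B ++ XB) = (size B + size B)%N by rewrite size_cat (size_map _ B).
rewrite -(limg_ker_dim (linfun Xf) fullv) capfv leq_add //.
exact: leq_trans le_ker le_img.
Qed.

End Freeness.

(** * The algebra of operators on the Koszul complex *)

Section Endomorphisms.
Variables (k : fieldType) (C : lmodType k).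

Fact linear_closed : linear (0 : C -> C) /\
  forall a (X Y : C -> C), linear X -> linear Y -> linear (a *: X + Y).
Proof.
split=> [b u v|a X Y Xl Yl b u v].
  by transitivity (b *: (0 : C) + 0); rewrite ?scaler0 ?addr0.
by rewrite !fctE Xl Yl !scalerDr !scalerA mulrC addrACA.
Qed.

Definition endo : Type := subm linear_closed.
HB.instance Definition _ := GRing.Lmodule.on endo.
Definition mkendo (X : C -> C) (Xl : linear X) : endo := mksubm linear_closed Xl.
Definition endo_fun (X : endo) : C -> C := subm_val X.
Coercion endo_fun : endo >-> Funclass.
Implicit Types X Y Z : endo.

Lemma endo_linear X : linear (X : C -> C). Proof. exact: submP. Qed.

Lemma endoP X Y : (forall c, X c = Y c) -> X = Y.
Proof. by move=> E; apply: subm_inj; apply/funext. Qed.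

Fact endo1_subproof : linear (@id C). Proof. by []. Qed.
Definition endo1 : endo := mkendo endo1_subproof.
Definition endo_mul X Y : endo :=
  mkendo (comp_linear (endo_linear X) (endo_linear Y)).

Lemma endoD X Y c : (X + Y : endo) c = X c + Y c. Proof. by []. Qed.
Lemma endoZ a X c : (a *: X : endo) c = a *: X c. Proof. by []. Qed.
Lemma endoN X c : (- X : endo) c = - X c. Proof. by []. Qed.
Lemma endo_sum I (r : seq I) (P : pred I) (F : I -> endo) c :
  (\sum_(i <- r | P i) F i : endo) c = \sum_(i <- r | P i) F i c.
Proof. by elim/big_rec2: _ => // i u v _ <-. Qed.

Fact endo_mulA : associative endo_mul. Proof. by move=> X Y Z; apply: endoP. Qed.
Fact endo_mul1l : left_id endo1 endo_mul. Proof. by move=> X; apply: endoP. Qed.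
Fact endo_mul1r : right_id endo1 endo_mul. Proof. by move=> X; apply: endoP. Qed.
Fact endo_mulDl : left_distributive endo_mul +%R.
Proof. by move=> X Y Z; apply: endoP. Qed.
Fact endo_mulDr : right_distributive endo_mul +%R.
Proof. by move=> X Y Z; apply: endoP => c; apply: (linD (endo_linear X)). Qed.
HB.instance Definition _ := GRing.Zmodule_isPzRing.Build endo
  endo_mulA endo_mul1l endo_mul1r endo_mulDl endo_mulDr.

Lemma endoM X Y c : (X * Y : endo) c = X (Y c). Proof. by []. Qed.
Lemma endo1E c : (1 : endo) c = c. Proof. by []. Qed.

Lemma endoZl a X Y : (a *: X) * Y = a *: (X * Y). Proof. exact: endoP. Qed.
Lemma endoZr a X Y : X * (a *: Y) = a *: (X * Y).
Proof. by apply: endoP => c; apply: (linZ (endo_linear X)). Qed.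

End Endomorphisms.

(** Powers are abstracted first, so that [ring] faces a polynomial identity in independent signs. *)
Local Ltac sign_ring := repeat
  match goal with |- context [@GRing.exp ?R ?a ?n] =>
    let x := fresh "x" in move: (@GRing.exp R a n) => x
  end; ring.

(** * Generators, contractions and coefficient operators on cochains *)

Section KoszulOperators.
Variables (k : fieldType) (g : lieSuperalgebra k) (V : lmodType k).
Variables (MS : smodStruct g V).
Implicit Types (i j l r : gen g) (S : mono0 g) (m : mono1 g) (a b : bool).
Local Notation d := (sdim g true).
Local Notation sgn b := ((-1) ^+ (b : bool) : k).
Local Notation ks := (@ksign k g).

Definition cochains : lmodType k := (mono0 g -> mono1 g -> V).
Local Notation R := (endo cochains).
Implicit Types (c e : cochains) (X Y Z : R).

Lemma cochainP c e : (forall S m, c S m = e S m) -> c = e.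
Proof. by move=> E; apply/funext => S; apply/funext => m. Qed.

Lemma cochainD c e S m : (c + e) S m = c S m + e S m. Proof. by []. Qed.
Lemma cochainZ x c S m : (x *: c) S m = x *: c S m. Proof. by []. Qed.
Lemma cochainN c S m : (- c) S m = - c S m. Proof. by []. Qed.
Lemma cochain_sum I (s : seq I) (P : pred I) (F : I -> cochains) S m :
  (\sum_(i <- s | P i) F i) S m = \sum_(i <- s | P i) F i S m.
Proof. by elim/big_rec2: _ => // i u v _ <-. Qed.

Fact mulgen_linear i : linear (mulgen i : cochains -> cochains).
Proof.
move=> x c e; apply: cochainP => S m; rewrite cochainD cochainZ.
case: i => j /=; case: ifP => _; rewrite ?scaler0 ?addr0 //;
  by rewrite cochainD cochainZ scalerDr !scalerA mulrC.
Qed.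
Definition opE i : R := mkendo (mulgen_linear i).

Fact dergen_linear i : linear (dergen i : cochains -> cochains).
Proof.
move=> x c e; apply: cochainP => S m; rewrite cochainD cochainZ.
case: i => j /=; first case: ifP => _; rewrite ?scaler0 ?addr0 //;
  by rewrite cochainD cochainZ scalerDr !scalerA mulrC.
Qed.
Definition opA i : R := mkendo (dergen_linear i).

(* For b = true this is F with the Koszul sign for moving an odd F past xi_S y^m. *)
Fact pointwise_linear b (F : V -> V) : linear F ->
  linear ((fun c S m => sgn (b && odd (mdeg m)) *: F (c S m)) : cochains -> cochains).
Proof.
move=> Fl x c e; apply: cochainP => S m; rewrite !(cochainD, cochainZ) Fl.
by rewrite scalerDr !scalerA mulrC.
Qed.
Definition opV b F (Fl : linear F) : R := mkendo (pointwise_linear b Fl).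

Definition oprho i : R := opV (gpar i) (act_linearr MS (gbas i)).
Lemma psgn_lin : linear (fun v => spr MS false v - spr MS true v).
Proof. by move=> x u v; rewrite !spr_linear opprD addrACA -scalerBr. Qed.
(** Since xi_S is even and y^m has parity [mdeg m], this is the parity involution of Lambda_s(g^* )
    (x) V: commuting with it means being even. *)
Definition optau : R := opV true psgn_lin.

Lemma opEE i c S m : opE i c S m = mulgen i c S m. Proof. by []. Qed.
Lemma opAE i c S m : opA i c S m = dergen i c S m. Proof. by []. Qed.
Lemma opVE b F (Fl : linear F) c S m :
  opV b Fl c S m = sgn (b && odd (mdeg m)) *: F (c S m).
Proof. by []. Qed.

Let cnt S (j : 'I_(sdim g false)) := #|[set l in S | (l < j)%N]|.

Lemma sgn_cntD1 S (i j : 'I_(sdim g false)) : i \in S ->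
  (-1) ^+ cnt (S :\ i) j = (-1) ^+ (i < j)%N * (-1) ^+ cnt S j :> k.
Proof.
move=> iS; rewrite /cnt.
have -> : [set l in S :\ i | (l < j)%N] = [set l in S | (l < j)%N] :\ i.
  by apply/setP => l; rewrite !inE andbA.
have [ij|ij] := boolP (i < j)%N; last first.
  rewrite expr0 mul1r (_ : _ :\ i = [set l in S | (l < j)%N]) //.
  by apply/setP => l; rewrite !inE; case: eqP => // ->; rewrite (negPf ij) andbF.
rewrite [in RHS](cardsD1 i [set l in S | _]) !inE iS ij exprD expr1.
by rewrite mulrA mulrNN mulr1 mul1r.
Qed.

Lemma sgn_cntU1 S (i j : 'I_(sdim g false)) : i \notin S ->
  (-1) ^+ cnt (i |: S) j = (-1) ^+ (i < j)%N * (-1) ^+ cnt S j :> k.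
Proof.
move=> iS; have := sgn_cntD1 j (setU11 i S); rewrite setU1K // => ->.
by rewrite mulrA -expr2 sqrr_sign mul1r.
Qed.

Lemma sgn_cardD1 S (i : 'I_(sdim g false)) : i \in S -> (-1) ^+ #|S :\ i| = - (-1) ^+ #|S| :> k.
Proof. by move=> iS; rewrite [in RHS](cardsD1 i) iS add1n exprS mulN1r opprK. Qed.

Lemma sgn_cardU1 S (i : 'I_(sdim g false)) : i \notin S -> (-1) ^+ #|i |: S| = - (-1) ^+ #|S| :> k.
Proof. by move=> iS; rewrite cardsU1 iS add1n exprS mulN1r. Qed.

Lemma opE_comm i j : opE i * opE j = - ks i j *: (opE j * opE i).
Proof.
apply: endoP => c; apply: cochainP => S m.
rewrite endoZ cochainZ !endoM !opEE; case: i j => i [] j; rewrite /ksign /= ?expr0 ?expr1.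
- rewrite ?opEE /= !inE -!/(cnt _ _); have [<-|Nij] := eqVneq i j.
    by rewrite /= scaler0 if_same scaler0.
  have [iS|] := boolP (i \in S); have [jS|] := boolP (j \in S); rewrite ?scaler0 //=.
  rewrite !scalerA (setDDl _ [set i]) (setUC [set i]) -setDDl.
  congr (_ *: _); rewrite !sgn_cntD1 //.
  case: ltngtP Nij => [ij _|ji _|/val_inj->]; rewrite ?eqxx //= ?expr0 ?expr1; sign_ring.
- rewrite ?opEE /=; have [iS|iS] := boolP (i \in S); have [m0|m0] := boolP (0 < m j)%N;
    rewrite ?scaler0 //= !scalerA sgn_cardD1 //; congr (_ *: _); sign_ring.
- rewrite ?opEE /=; have [iS|iS] := boolP (j \in S); have [m0|m0] := boolP (0 < m i)%N;
    rewrite ?scaler0 //= !scalerA sgn_cardD1 //; congr (_ *: _); sign_ring.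
- rewrite ?opEE /= opprK scale1r !mnmBE !mnm1E.
  have [->|Nij] := eqVneq i j; first by [].
  rewrite !subn0.
  have [mi|mi] := boolP (0 < m i)%N; have [mj|mj] := boolP (0 < m j)%N; rewrite ?scaler0 //=.
  by rewrite !submDA (addmC U_(i)%MM).
Qed.

(** With [opE_comm] and [opA_opE] this gives mixed Clifford and Weyl relations: anticommutators for
    even generators, commutators for odd ones. The identities for the differential follow from them
    formally. *)
Lemma opA_opE_id i : opA i * opE i + ks i i *: (opE i * opA i) = 1.
Proof.
apply: endoP => c; apply: cochainP => S m.
rewrite endoD endoZ cochainD cochainZ endo1E !endoM !opEE !opAE.
case: i => j; rewrite /ksign /= ?expr0 ?expr1.
- rewrite -!/(cnt _ _) !inE eqxx /= scale1r.
  have [jS|jS] := boolP (j \in S).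
    rewrite add0r !scalerA setD1K // sgn_cntD1 // ltnn expr0 mul1r.
    by rewrite -expr2 sqrr_sign scale1r.
  by rewrite addr0 !scalerA setU1K // sgn_cntU1 // ltnn expr0 mul1r -expr2 sqrr_sign scale1r.
- rewrite scaleN1r mnmDE mnm1E eqxx addn1 /= addmK.
  have [mj|mj] := boolP (0 < m j)%N.
    rewrite submK ?lep1mP -?lt0n // !scalerA -scalerBl.
    rewrite mnmBE mnm1E eqxx subn1 prednK // -[RHS]scale1r; congr (_ *: _).
    rewrite -addn1 natrD; have := sqrr_sign k #|S|; rewrite expr2.
    by move: (_ ^+ _) => x E; transitivity (x * x); first ring.
  rewrite subr0 scalerA; move: mj; rewrite lt0n negbK => /eqP ->.
  by rewrite mulr1 -expr2 sqrr_sign scale1r.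
Qed.

Lemma opA_opE r i : i != r -> opA r * opE i = - ks i r *: (opE i * opA r).
Proof.
move=> Nir; apply: endoP => c; apply: cochainP => S m.
rewrite endoZ cochainZ !endoM !opEE !opAE.
case: i r Nir => i [] j Nij; rewrite /ksign /= ?expr0 ?expr1.
- have {}Nij : i != j by [].
  rewrite -!/(cnt _ _) !inE (negPf Nij) (eq_sym j) (negPf Nij) /=.
  have [jS|jS] := boolP (j \in S); have [iS|iS] := boolP (i \in S); rewrite ?scaler0 //=.
  rewrite !scalerA.
  have -> : (j |: S) :\ i = j |: S :\ i.
    by apply/setP => l; rewrite !inE; case: (eqVneq l i) => // ->; rewrite (negPf Nij).
  rewrite sgn_cntU1 // sgn_cntD1 //; congr (_ *: _).
  case: ltngtP Nij => [ij _|ji _|/val_inj->]; rewrite ?eqxx //= ?expr0 ?expr1; sign_ring.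
- have [iS|iS] := boolP (i \in S); rewrite ?scaler0 // !scalerA.
  by rewrite sgn_cardD1 //; congr (_ *: _); sign_ring.
- have [iS|iS] := boolP (j \in S); have [mi|mi] := boolP (0 < m i)%N; rewrite ?scaler0 //.
  by rewrite !scalerA sgn_cardU1 //; congr (_ *: _); sign_ring.
- have {}Nij : i != j by [].
  rewrite opprK scale1r mnmDE mnm1E (eq_sym j) (negPf Nij) addn0.
  have [mi|mi] := boolP (0 < m i)%N; last by rewrite scaler0.
  rewrite !scalerA mnmBE mnm1E (negPf Nij) subn0.
  have -> : (m + U_(j) - U_(i) = m - U_(i) + U_(j))%MM.
    by rewrite (addmC m) [RHS]addmC addmBA ?lep1mP -?lt0n.
  by rewrite mulrC.
Qed.

Lemma odd_mdegD1 m (j : 'I_d) : odd (mdeg (m + U_(j))%MM) = ~~ odd (mdeg m).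
Proof. by rewrite mdegD mdeg1 addn1. Qed.

Lemma odd_mdegB1 m (j : 'I_d) : (0 < m j)%N ->
  odd (mdeg (m - U_(j))%MM) = ~~ odd (mdeg m).
Proof.
by move=> m0; rewrite -[in RHS](@submK _ U_(j)%MM m) ?lep1mP -?lt0n // odd_mdegD1 negbK.
Qed.

Lemma opV_mul b b' (F G : V -> V) (Fl : linear F) (Gl : linear G) :
  opV b Fl * opV b' Gl = opV (b (+) b') (comp_linear Fl Gl).
Proof.
apply: endoP => c; apply: cochainP => S m; rewrite endoM !opVE.
by rewrite (linZ Fl) scalerA andb_addl signr_addb.
Qed.

Lemma opV_opE b (F : V -> V) (Fl : linear F) i :
  opV b Fl * opE i = sgn (b && gpar i) *: (opE i * opV b Fl).
Proof.
apply: endoP => c; apply: cochainP => S m; rewrite endoZ cochainZ !endoM opVE !opEE.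
case: i => j /=; case: ifP => mj; rewrite ?(lin0 Fl) ?scaler0 // ?opVE (linZ Fl).
  by rewrite andbF expr0 scale1r !scalerA mulrC.
rewrite !scalerA odd_mdegB1 // andbT; congr (_ *: _).
case: b; rewrite /= ?expr0 ?expr1; last by rewrite !mul1r mulr1.
by case: odd; rewrite /= ?expr0 ?expr1 !(mulN1r, mulrN1, mul1r, mulr1, opprK).
Qed.

Lemma opV_opA b (F : V -> V) (Fl : linear F) i :
  opV b Fl * opA i = sgn (b && gpar i) *: (opA i * opV b Fl).
Proof.
apply: endoP => c; apply: cochainP => S m; rewrite endoZ cochainZ !endoM opVE !opAE.
case: i => j /=.
  case: ifP => mj; rewrite ?(lin0 Fl) ?scaler0 // ?opVE (linZ Fl).
  by rewrite andbF expr0 scale1r !scalerA mulrC.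
rewrite ?opVE (linZ Fl) !scalerA odd_mdegD1 andbT; congr (_ *: _).
by case: b; rewrite /= ?expr0 ?expr1 ?signrN; sign_ring.
Qed.

Lemma oprho_opE i j : oprho i * opE j = ks i j *: (opE j * oprho i).
Proof. exact: opV_opE. Qed.

Lemma psgn_act_gbas i v : let s v := spr MS false v - spr MS true v in
  s (act MS (gbas i) v) = sgn (gpar i) *: act MS (gbas i) (s v).
Proof.
rewrite /= !(spr_act MS _ _ (gbas_par i)) actB /=.
by case: (gpar i); rewrite /= ?scaleN1r ?scale1r ?opprB.
Qed.

Lemma oprho_tau i : optau * oprho i = sgn (gpar i) *: (oprho i * optau).
Proof.
rewrite /optau /oprho !opV_mul; apply: endoP => c; apply: cochainP => S m.
rewrite endoZ cochainZ !opVE /= psgn_act_gbas.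
by rewrite !scalerA addbC mulrC.
Qed.

Lemma oprho_comm i j :
  oprho i * oprho j - ks i j *: (oprho j * oprho i) = \sum_r strc i j r *: oprho r.
Proof.
apply: endoP => c; apply: cochainP => S m.
rewrite endo_sum cochain_sum endoD endoN endoZ cochainD cochainN cochainZ.
rewrite /oprho !opV_mul !opVE /= scalerA mulrC -scalerA (addbC (gpar j)) -scalerBr.
rewrite act_gbas_commute scaler_sumr; apply: eq_bigr => r _.
transitivity (strc i j r *: (sgn (gpar r && odd (mdeg m)) *: act MS (gbas r) (c S m))) => //.
rewrite !scalerA mulrC.
have [->|/strc_par ->//] := eqVneq (strc i j r) 0.
by rewrite !mul0r.
Qed.

(** * The Koszul differential *)

Lemma scale_swap (U : lmodType k) (x y : k) (u : U) : x *: (y *: u) = y *: (x *: u).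
Proof. by rewrite !scalerA mulrC. Qed.

Let kap i j r : k := ks i j * strc i j r.

Lemma kap_neq0 i j r : kap i j r != 0 -> gpar r = gpar i (+) gpar j.
Proof. by rewrite /kap mulf_eq0 negb_or => /andP[_ /strc_par]. Qed.

Lemma kap_sum_ext i j r X Y : (gpar r = gpar i (+) gpar j -> X = Y) ->
  kap i j r *: X = kap i j r *: Y.
Proof.
by move=> XY; have [->|/kap_neq0/XY->//] := eqVneq (kap i j r) 0; rewrite !scale0r.
Qed.

(* Locked, since rewriting with endoZl or mulrA would otherwise unfold them. *)
Fact op_key : unit. Proof. exact: tt. Qed.
(** [opW r] multiplies by d(xi_r), [opK] is the derivation extending d, [opQ] carries the action on
    V, and [opD] is the differential of Lambda_s(g^* ) (x) V. *)
Definition opW r : R := locked_with op_key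
  (2%:R^-1 *: \sum_i \sum_j kap i j r *: (opE i * opE j)).
Definition opK : R := locked_with op_key (\sum_r opW r * opA r).
Definition opQ : R := locked_with op_key (\sum_i opE i * oprho i).
Definition opD : R := locked_with op_key (opK - opQ).

Lemma opWE r : opW r = 2%:R^-1 *: \sum_i \sum_j kap i j r *: (opE i * opE j).
Proof. by rewrite /opW unlock. Qed.
Lemma opK_sum : opK = \sum_r opW r * opA r. Proof. by rewrite /opK unlock. Qed.
Lemma opQ_sum : opQ = \sum_i opE i * oprho i. Proof. by rewrite /opQ unlock. Qed.
Lemma opD_def : opD = opK - opQ. Proof. by rewrite /opD unlock. Qed.

Lemma opKE c S m : opK c S m = kdiff c S m.
Proof.
rewrite opK_sum endo_sum cochain_sum /kdiff.
rewrite (eq_bigr (fun r => 2%:R^-1 *: \sum_i \sum_j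
  kap i j r *: mulgen i (mulgen j (dergen r c)) S m)).
  rewrite -scaler_sumr exchange_big; congr (_ *: _); apply: eq_bigr => i _.
  by rewrite exchange_big.
move=> r _; rewrite endoM opWE endoZ cochainZ endo_sum cochain_sum; congr (_ *: _).
by apply: eq_bigr => i _; rewrite endo_sum cochain_sum.
Qed.

(** The sign rule for an operator of parity [b] and Z-degree 0. *)
Definition semicommutes b X (opX : gen g -> R) :=
  forall i, X * opX i = sgn (b && gpar i) *: (opX i * X).

Lemma semicommutes_opW b X r : semicommutes b X opE ->
  X * opW r = sgn (b && gpar r) *: (opW r * X).
Proof.
move=> XE; rewrite opWE endoZr endoZl scale_swap; congr (_ *: _).
rewrite mulr_sumr mulr_suml scaler_sumr; apply: eq_bigr => i _.
rewrite mulr_sumr mulr_suml scaler_sumr; apply: eq_bigr => j _.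
rewrite endoZr endoZl scale_swap; apply: kap_sum_ext => ->.
rewrite mulrA XE endoZl -mulrA XE endoZr scalerA mulrA.
by rewrite andb_addr signr_addb.
Qed.

Lemma semicommutes_opK b X : semicommutes b X opE -> semicommutes b X opA ->
  X * opK = opK * X.
Proof.
move=> XE XA; rewrite opK_sum mulr_sumr mulr_suml; apply: eq_bigr => r _.
rewrite mulrA (semicommutes_opW _ XE) endoZl -mulrA XA endoZr scalerA -expr2 sqrr_sign.
by rewrite scale1r mulrA.
Qed.

Lemma opE_opW l r : opE l * opW r = ks l r *: (opW r * opE l).
Proof.
rewrite opWE endoZr endoZl scale_swap; congr (_ *: _).
rewrite mulr_sumr mulr_suml scaler_sumr; apply: eq_bigr => i _.
rewrite mulr_sumr mulr_suml scaler_sumr; apply: eq_bigr => j _.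
rewrite endoZr endoZl scale_swap; apply: kap_sum_ext => Er.
rewrite mulrA opE_comm endoZl -mulrA (opE_comm l) endoZr scalerA mulrNN mulrA.
by rewrite /ksign Er andb_addr signr_addb.
Qed.

Lemma ksignK i j : ks i j * ks i j = 1.
Proof. by rewrite -expr2 sqrr_sign. Qed.

Lemma opK_opE l : opK * opE l + opE l * opK = opW l.
Proof.
rewrite opK_sum mulr_sumr mulr_suml -big_split (bigD1 l) //=.
rewrite big1 => [|r Nr].
  have := opA_opE_id l; move/(canRL (addrK _)) => E.
  rewrite addr0 -mulrA E mulrBr mulr1 mulrA opE_opW endoZr endoZl mulrA.
  by rewrite addrNK.
rewrite -mulrA opA_opE 1?eq_sym // mulrA opE_opW endoZr endoZl mulrA.
by rewrite scaleNr addNr.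
Qed.

Lemma opK_oprho i : oprho i * opK = opK * oprho i.
Proof. by apply: semicommutes_opK => j; [apply: opV_opE|apply: opV_opA]. Qed.

Lemma opK_opQ : opK * opQ + opQ * opK = \sum_i opW i * oprho i.
Proof.
rewrite opQ_sum mulr_sumr mulr_suml -big_split; apply: eq_bigr => i _ /=.
by rewrite -mulrA opK_oprho !mulrA -mulrDl opK_opE.
Qed.

(** Exchanging i and j in the double sum turns twice the product into a sum of supercommutators of
    the e_i, which the module axiom expresses through the structure constants. *)
Lemma opQ_opQ : 2%:R != 0 :> k -> opQ * opQ = \sum_i opW i * oprho i.
Proof.
move=> two; apply: (scalerI two).
pose F i j := ks i j *: (opE i * opE j * (oprho i * oprho j)).
have E1 : opQ * opQ = \sum_i \sum_j F i j.
  rewrite opQ_sum mulr_suml; apply: eq_bigr => i _; rewrite mulr_sumr.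
  apply: eq_bigr => j _; rewrite -!mulrA (mulrA (oprho i)).
  by rewrite oprho_opE endoZl endoZr /F !mulrA.
have E2 : opQ * opQ = - \sum_i \sum_j opE i * opE j * (oprho j * oprho i).
  rewrite E1 exchange_big -sumrN; apply: eq_bigr => i _; rewrite -sumrN.
  apply: eq_bigr => j _; rewrite /F opE_comm endoZl scalerA mulrN.
  by rewrite ksignK scaleN1r.
rewrite scaler_nat mulr2n {1}E1 E2 -sumrB scaler_sumr.
rewrite (eq_bigr (fun i => \sum_j \sum_r kap i j r *: (opE i * opE j * oprho r))).
  rewrite (eq_bigr (fun i => \sum_r \sum_j kap i j r *: (opE i * opE j * oprho r))).
    rewrite exchange_big; apply: eq_bigr => r _; rewrite opWE endoZl scalerA divff //.
    rewrite scale1r mulr_suml; apply: eq_bigr => i _; rewrite mulr_suml.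
    by apply: eq_bigr => j _; rewrite endoZl.
  by move=> i _; rewrite exchange_big.
move=> i _; rewrite -sumrB; apply: eq_bigr => j _.
rewrite -(scale1r (opE i * opE j * (oprho j * _))) -(ksignK i j) -scalerA -scalerBr.
rewrite -endoZr -mulrBr oprho_comm mulr_sumr scaler_sumr.
by apply: eq_bigr => r _; rewrite endoZr scalerA.
Qed.

(** The module terms cancel, so D^2 commutes with every operator that semicommutes with all
    generators and contractions. *)
Lemma opD_sqr : 2%:R != 0 :> k -> opD * opD = opK * opK.
Proof.
move=> two; rewrite opD_def mulrBl !mulrBr opQ_opQ // -opK_opQ.
by rewrite opprB addrK addrNK.
Qed.

Lemma opQ_opE i : opQ * opE i + opE i * opQ = 0.
Proof.
rewrite opQ_sum mulr_sumr mulr_suml -big_split big1 // => j _ /=.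
rewrite -mulrA oprho_opE endoZr !mulrA (opE_comm i) endoZl.
by rewrite /ksign (andbC (gpar i)) scaleNr addrN.
Qed.

Lemma opD_opE i : opD * opE i + opE i * opD = opW i.
Proof.
by rewrite opD_def mulrBl mulrBr addrACA -opprD opK_opE opQ_opE subr0.
Qed.

Lemma optau_opD : optau * opD = opD * optau.
Proof.
rewrite opD_def mulrBl mulrBr; congr (_ - _).
  by apply: (@semicommutes_opK true) => j; [exact: opV_opE|exact: opV_opA].
rewrite opQ_sum mulr_sumr mulr_suml; apply: eq_bigr => i _.
rewrite mulrA opV_opE endoZl -mulrA oprho_tau endoZr scalerA /=.
by rewrite -expr2 sqrr_sign scale1r mulrA.
Qed.

(** * Multiplication by polynomials *)

Lemma mpoly_mulX_ind (P : {mpoly k[d]} -> Prop) :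
  (forall x f h, P f -> P h -> P (x *: f + h)) -> P 1 ->
  (forall (j : 'I_d) f, P f -> P ('X_j * f)) -> forall f, P f.
Proof.
move=> PD P1 PX.
have P0 : P 0 by have := PD (-1) _ _ P1 P1; rewrite scaleN1r addNr.
have Pm m : P 'X_[m].
  have [n] := ubnP (mdeg m); elim: n m => // n IH m; rewrite ltnS => mn.
  have [/eqP|m0] := posnP (mdeg m); first by rewrite mdeg_eq0 => /eqP ->; rewrite mpolyX0.
  have [j mj] : exists j : 'I_d, (0 < m j)%N.
    apply/existsP; apply: contraTT m0; rewrite negb_exists -leqNgt => /forallP m0.
    by rewrite mdegE leqn0 sum_nat_eq0; apply/forallP => j; rewrite -leqn0 leqNgt m0.
  rewrite -(@submK _ U_(j)%MM m) ?lep1mP -?lt0n // addmC mpolyXD; apply/PX/IH.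
  by rewrite (leq_trans _ mn) // -[in X in (_ < X)%N](@submK _ U_(j)%MM m) ?lep1mP -?lt0n //
     mdegD mdeg1 addn1.
by elim/mpolyind => [//|x m f _ _ Pf]; apply: PD.
Qed.

(** The polynomial enters on the left and has to pass xi_S, whose factors anticommute with every
    y_j; this is the origin of the sign. *)
Definition mulpoly (f : {mpoly k[d]}) (c : cochains) : cochains := fun S m =>
  \sum_(n : bmultinom d (mdeg m).+1 | (n <= m)%MM)
    (f@_n * sgn (odd #|S| && odd (mdeg n))) *: c S (m - n)%MM.

Fact mulpoly_linear f : linear (mulpoly f).
Proof.
move=> x c e; apply: cochainP => S m; rewrite cochainD cochainZ /mulpoly.
rewrite scaler_sumr -big_split; apply: eq_bigr => n _ /=.
by rewrite cochainD cochainZ scalerDr scale_swap.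
Qed.
Definition opY f : R := mkendo (mulpoly_linear f).

Lemma opY_linear x f h : opY (x *: f + h) = x *: opY f + opY h.
Proof.
apply: endoP => c; apply: cochainP => S m.
rewrite endoD endoZ cochainD cochainZ /= /mulpoly scaler_sumr -big_split.
by apply: eq_bigr => n _; rewrite mcoeffD mcoeffZ mulrDl scalerDl -mulrA scalerA.
Qed.

Lemma mulpolyX n c S m : mulpoly 'X_[n] c S m =
  if (n <= m)%MM then sgn (odd #|S| && odd (mdeg n)) *: c S (m - n)%MM else 0.
Proof.
rewrite /mulpoly; have [nm|nm] := boolP (n <= m)%MM.
  have lt_n : (mdeg n < (mdeg m).+1)%N.
    by rewrite ltnS -(submK nm) mdegD leq_addl.
  rewrite (bigD1 (BMultinom lt_n)) //= mcoeffX eqxx mul1r big1 ?addr0 // => n' /andP[_ Nn].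
  rewrite mcoeffX (_ : (n == n') = false) ?mul0r ?scale0r //.
  by apply: contraNF Nn => /eqP E; apply/eqP/val_inj.
rewrite big1 // => n' n'm; rewrite mcoeffX; case: eqP => [E|_]; last by rewrite mul0r scale0r.
by rewrite E n'm in nm.
Qed.

Lemma opYD f h : opY (f + h) = opY f + opY h.
Proof. by rewrite -[f]scale1r opY_linear !scale1r. Qed.
Lemma opY0 : opY 0 = 0.
Proof. by have := opY_linear (-1) 0 0; rewrite scaler0 addr0 scaleN1r addNr. Qed.
Lemma opYZ x f : opY (x *: f) = x *: opY f.
Proof. by rewrite -[x *: f]addr0 opY_linear opY0 addr0. Qed.
Lemma opYN f : opY (- f) = - opY f.
Proof. by rewrite -scaleN1r opYZ scaleN1r. Qed.
Lemma opY_sum I (s : seq I) (P : pred I) (F : I -> {mpoly k[d]}) :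
  opY (\sum_(i <- s | P i) F i) = \sum_(i <- s | P i) opY (F i).
Proof. by elim/big_rec2: _ => [|i X f _ <-]; rewrite ?opY0 ?opYD. Qed.

Lemma opY1 : opY 1 = 1.
Proof.
apply: endoP => c; apply: cochainP => S m; rewrite -mpolyX0 endo1E [LHS]mulpolyX.
rewrite ifT; last by apply/mnm_lepP => i; rewrite mnm0E.
by rewrite mdeg0 andbF expr0 scale1r subm0.
Qed.

Lemma opY_mulX (j : 'I_d) f : opY ('X_j * f) = opE (inr j) * opY f.
Proof.
elim/mpolyind: f => [|x m f _ _ IH]; first by rewrite mulr0 opY0 mulr0.
rewrite mulrDr opY_linear -scalerAr opY_linear IH mulrDr endoZr; congr (_ *: _ + _).
rewrite -mpolyXD; apply: endoP => c; apply: cochainP => S n.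
rewrite [LHS]mulpolyX endoM opEE /= mulpolyX.
have [nj|nj] := boolP (0 < n j)%N; last first.
  rewrite ifF //; apply: contraNF nj => /mnm_lepP/(_ j).
  by rewrite mnmDE mnm1E eqxx; apply: leq_trans.
have -> : (U_(j) + m <= n)%MM = (m <= n - U_(j))%MM.
  apply/mnm_lepP/mnm_lepP => H i; have := H i; rewrite mnmDE mnmBE mnm1E.
    by rewrite leq_subRL; case: eqP => // <-.
  by case: eqP nj => [<-|] nj; rewrite ?subn0 // leq_subRL.
case: ifP => _; last by rewrite scaler0.
rewrite scalerA submDA; congr (_ *: _).
rewrite mdegD mdeg1 add1n /= -[in RHS]signr_odd.
by case: (odd #|S|); case: (odd (mdeg m)); rewrite /= ?expr0 ?expr1 ?mulr1 ?mul1r ?mulN1r ?opprK.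
Qed.

Lemma opYU (j : 'I_d) : opY 'X_j = opE (inr j).
Proof. by rewrite -['X_j]mulr1 opY_mulX opY1 mulr1. Qed.

Lemma opYM f h : opY (f * h) = opY f * opY h.
Proof.
elim/mpoly_mulX_ind: f h => [x f f' If If'||j f If] h.
- by rewrite mulrDl -scalerAl !opY_linear If If' mulrDl endoZl.
- by rewrite opY1 !mul1r.
- by rewrite -mulrA !opY_mulX If mulrA.
Qed.

Lemma opYX_exp f n : opY (f ^+ n) = opY f ^+ n.
Proof. by elim: n => [|n IH]; rewrite ?expr0 ?opY1 // !exprS opYM IH. Qed.

Lemma opY_comm f h : opY f * opY h = opY h * opY f.
Proof. by rewrite -!opYM mulrC. Qed.

(** Moving an even generator past f replaces each y_j by -y_j. The fixed polynomials, those of even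
    degrees, commute with all generators. *)
Definition ysign : {mpoly k[d]} -> {mpoly k[d]} :=
  mmap (@mpolyC d k) (fun j : 'I_d => - 'X_j).
HB.instance Definition _ := GRing.RMorphism.on ysign.

Lemma ysignX (j : 'I_d) : ysign 'X_j = - 'X_j.
Proof. by rewrite /ysign mmapX mmap1U. Qed.

Lemma ysignD f h : ysign (f + h) = ysign f + ysign h.
Proof. exact: raddfD. Qed.

Lemma ysignZ x f : ysign (x *: f) = x *: ysign f.
Proof. by rewrite /ysign mmapZ mul_mpolyC. Qed.

Lemma opY_semicommutes b X f :
  (forall j : 'I_d, X * opE (inr j) = sgn b *: (opE (inr j) * X)) ->
  X * opY f = opY (iter b ysign f) * X.
Proof.
move=> XE; elim/mpoly_mulX_ind: f => [x f h If Ih||j f If].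
- rewrite opY_linear mulrDr endoZr If Ih.
  by case: b {XE If Ih} => /=; rewrite ?ysignD ?ysignZ opY_linear mulrDl endoZl.
- by case: b {XE} => /=; rewrite ?rmorph1 !opY1 mulr1 mul1r.
- rewrite opY_mulX mulrA XE endoZl -mulrA If.
  case: b {XE If} => /=; rewrite ?scale1r ?opY_mulX ?mulrA //.
  by rewrite rmorphM /= ysignX mulNr opYN opY_mulX expr1 scaleN1r mulNr.
Qed.

Lemma opE_opY i f : opE i * opY f = opY (iter (~~ gpar i) ysign f) * opE i.
Proof.
apply: opY_semicommutes => j; rewrite opE_comm /ksign andbT.
by case: gpar; rewrite /= ?opprK.
Qed.

Lemma oprho_opY i f : oprho i * opY f = opY (iter (gpar i) ysign f) * oprho i.
Proof. by apply: opY_semicommutes => j; rewrite oprho_opE /ksign andbT. Qed.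

Lemma opV_opY b (F : V -> V) (Fl : linear F) f :
  opV b Fl * opY f = opY (iter b ysign f) * opV b Fl.
Proof. by apply: opY_semicommutes => j; rewrite opV_opE andbT. Qed.

Lemma iter_ysign b f : ysign f = f -> iter b ysign f = f.
Proof. by case: b. Qed.

Lemma opQ_opY f : ysign f = f -> opQ * opY f = opY f * opQ.
Proof.
move=> sf; rewrite opQ_sum mulr_sumr mulr_suml; apply: eq_bigr => i _.
by rewrite -mulrA oprho_opY iter_ysign // mulrA opE_opY iter_ysign // mulrA.
Qed.

(** The chain rule df = sum_j d(y_j) df/dy_j, with the sign of a derivation of Z-degree 1. *)
Lemma opK_opY f : opK * opY f =
  opY (ysign f) * opK + \sum_(j < d) opW (inr j) * opY (mderiv j f).
Proof.
elim/mpoly_mulX_ind: f => [x f h If Ih||j f If].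
- rewrite opY_linear mulrDr endoZr If Ih ysignD ysignZ opY_linear mulrDl endoZl.
  rewrite scalerDr addrACA; congr (_ + _); rewrite scaler_sumr -big_split.
  by apply: eq_bigr => j _; rewrite /= mderivD mderivZ opY_linear mulrDr endoZr.
- rewrite rmorph1 opY1 mulr1 mul1r big1 ?addr0 // => j _.
  by rewrite -mpolyC1 mderivC opY0 mulr0.
- rewrite opY_mulX mulrA (canRL (addrK _) (opK_opE _)) mulrBl -mulrA If.
  rewrite rmorphM /= ysignX mulNr opYN opY_mulX mulNr mulrDr opprD addrCA mulrA; congr (_ + _).
  rewrite mulr_sumr (bigD1 j) //= [in RHS](bigD1 j) //=.
  have E (l : 'I_d) : opW (inr l) * opY (mderiv l ('X_j * f)) =
     (j == l)%:R *: (opW (inr l) * opY f) - opE (inr j) * (opW (inr l) * opY (mderiv l f)).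
    rewrite mderivM mderivX mnm1E opYD opYM mulrDr; congr (_ + _).
      case: eqP => [->|_]; last by rewrite !scale0r mul0r opY0 mulr0.
      rewrite (_ : (U_(l) - U_(l))%MM = 0%MM) ?mpolyX0 ?scale1r ?mul1r //.
      by apply/mnmP => i; rewrite mnmBE subnn mnm0E.
    rewrite opYU mulrA [in RHS]mulrA opE_opW endoZl /ksign /= expr1.
    by rewrite scaleN1r opprK.
  rewrite E eqxx scale1r opprD addrA; congr (_ + _).
  rewrite -sumrN; apply: eq_bigr => l lj.
  by rewrite E eq_sym (negPf lj) scale0r sub0r.
Qed.

Lemma mderiv_expp p (j : 'I_d) (f : {mpoly k[d]}) :
  p \in [pchar k] -> mderiv j (f ^+ p) = 0.
Proof.
move=> pk.
have p0 : (p%:R : {mpoly k[d]}) = 0.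
  by rewrite -(rmorph_nat (@mpolyC d k)) (pcharf0 pk) rmorph0.
have D n : mderiv j (f ^+ n) = n%:R * (f ^+ n.-1 * mderiv j f).
  elim: n => [|n IH]; first by rewrite expr0 -mpolyC1 mderivC mul0r.
  rewrite exprS mderivM IH; case: n {IH} => [|n] /=.
    by rewrite !expr0 mul0r mulr0 addr0 !mul1r mulr1.
  rewrite -(natr1 n.+1) mulrDl mul1r addrC exprS; congr (_ + _); last exact: mulrC.
  by rewrite mulrCA; congr (_ * _); exact: mulrA.
by rewrite D p0 mul0r.
Qed.

Lemma opK_opYp p f : p \in [pchar k] -> ysign f = f ->
  opK * opY (f ^+ p) = opY (f ^+ p) * opK.
Proof.
move=> pk sf; rewrite opK_opY rmorphXn /= sf big1 ?addr0 // => j _.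
by rewrite mderiv_expp // opY0 mulr0.
Qed.

(** * The square of the differential on even generators *)

Section EvenGenerators.
Hypothesis two_neq0 : 2%:R != 0 :> k.
Variable al : gen g.
Hypothesis al_even : gpar al = false.

Let jac i (a b : gen g) : k := gdual al (lbr (gbas i) (lbr (gbas a) (gbas b))).
Let t i (a b : gen g) : R := (ks i a * ks i b * ks a b * jac i a b) *: (opE i * opE a * opE b).

Lemma ksignC i j : ks i j = ks j i.
Proof. by rewrite /ksign andbC. Qed.

Let ks_add i l (a b : gen g) : gpar l = gpar a (+) gpar b -> ks i l = ks i a * ks i b.
Proof. by rewrite /ksign => ->; rewrite andb_addr signr_addb. Qed.

Let jac_cycle i (a b : gen g) :
  jac i a b + ks i a * ks i b * jac a b i + ks b i * ks b a * jac b i a = 0.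
Proof.
rewrite /jac (lbr_jacobi _ (gbas_par i) (gbas_par a)) -/(ks i a).
have ia : lbr (gbas i) (gbas a) \in lpart g (gpar i (+) gpar a).
  by apply: lbr_parity; apply: gbas_par.
rewrite (lbr_antisym ia (gbas_par b)) (lbr_antisym (gbas_par i) (gbas_par b)) -/(ks i b).
rewrite (linN (lbr_linearr _)) (linZ (lbr_linearr _)).
rewrite andb_addl signr_addb -/(ks i b) -/(ks a b).
rewrite gdualD -!scaleN1r !gdualZ (ksignC b i) (ksignC b a).
move: (gdual _ _) (gdual _ _) => x y; ring.
Qed.

Let t_cycle i (a b : gen g) : t i a b + t a b i + t b i a = 0.
Proof.
rewrite /t.
have -> : opE a * opE b * opE i = (ks i a * ks i b) *: (opE i * opE a * opE b).
  rewrite (opE_comm i a) endoZl -[opE a * opE i * _]mulrA (opE_comm i b) endoZr.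
  rewrite !scalerA mulrA -[LHS]scale1r; congr (_ *: _).
  transitivity ((ks i a * ks i a) * (ks i b * ks i b)); last ring.
  by rewrite !ksignK mulr1.
have -> : opE b * opE i * opE a = (ks b i * ks b a) *: (opE i * opE a * opE b).
  rewrite (opE_comm b i) endoZl -[opE i * opE b * _]mulrA (opE_comm b a) endoZr.
  by rewrite !scalerA mulrA; congr (_ *: _); ring.
rewrite !scalerA -!scalerDl.
have := jac_cycle i a b => /(congr1 (fun x => ks i a * ks i b * ks a b * x)).
rewrite mulr0 !mulrDr (ksignC a i) (ksignC b i) (ksignC b a) => E.
rewrite -[RHS](scale0r (opE i * opE a * opE b)) -E; congr (_ *: _).
ring.
Qed.

Let lt_gen i j := match i, j with inl i, inl j => (i < j)%N | inl _, inr _ => true | _, _ => false end.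
Let lead i (a b : gen g) := [&& ~~ gpar i, lt_gen i a & lt_gen i b].

Lemma opE_sqr_even i : gpar i = false -> opE i * opE i = 0.
Proof.
move=> ie; apply: (scalerI two_neq0); rewrite scaler0 scaler_nat mulr2n.
by rewrite {1}opE_comm /ksign ie expr0 scaleN1r addNr.
Qed.

(* The cyclic sums of t vanish, but in characteristic 3 this does not kill the
   total sum by division; instead each nonzero term has exactly one leading
   position: its least even index. *)
Let t_lead i (a b : gen g) : t i a b = (lead i a b + lead a b i + lead b i a)%:R *: t i a b.
Proof.
have [z|nz] := eqVneq (jac i a b) 0; first by rewrite /t z mulr0 scale0r scaler0.
(* The parities of i, a, b add up to that of [al], which is even: none or two of them are odd, and
   some even index is left to lead. *)
have Epar : gpar i (+) (gpar a (+) gpar b) = false.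
  apply/negbTE; apply: contraNN nz => P; rewrite /jac; apply/eqP.
  apply: (@gdual_par _ _ _ (gpar i (+) (gpar a (+) gpar b))).
    by apply: lbr_parity; [|apply: lbr_parity]; apply: gbas_par.
  by rewrite al_even P.
have t0 : opE i * opE a * opE b = 0 -> t i a b = (lead i a b + lead a b i + lead b i a)%:R *: t i a b.
  by rewrite /t => ->; rewrite !scaler0.
case: i a b nz Epar t0 => i [] a [] b //= _ _ t0; rewrite /lead /lt_gen /= ?addn0 ?add0n ?scale1r //.
have [ia|ia] := eqVneq i a; first by apply: t0; rewrite ia opE_sqr_even ?mul0r.
have [ab|ab] := eqVneq a b; first by apply: t0; rewrite ab -mulrA opE_sqr_even ?mulr0.
have [ib|ib] := eqVneq i b.
  by apply: t0; rewrite ib opE_comm endoZl -mulrA opE_sqr_even // mulr0 scaler0.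
move: ia ab ib; rewrite -!val_eqE /=.
case: (ltngtP i a) => //= ia _; case: (ltngtP a b) => //= ab _;
  case: (ltngtP i b) => //= ib _; rewrite ?scale1r //.
  by have := ltn_trans (ltn_trans ia ab) ib; rewrite ltnn.
by have := ltn_trans (ltn_trans ib ab) ia; rewrite ltnn.
Qed.

(** Cyclic relabelling brings the leading index to the front, leaving a sum over leading triples of
    full cyclic sums of t, which the Jacobi identity kills. *)
Let sum_t : \sum_i \sum_a \sum_b t i a b = 0.
Proof.
have E : \sum_i \sum_a \sum_b t i a b =
    \sum_i \sum_a \sum_b (lead i a b)%:R *: t i a b +
    \sum_i \sum_a \sum_b (lead a b i)%:R *: t i a b +
    \sum_i \sum_a \sum_b (lead b i a)%:R *: t i a b.
  rewrite -!big_split; apply: eq_bigr => i _; rewrite -!big_split; apply: eq_bigr => a _.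
  rewrite -!big_split; apply: eq_bigr => b _ /=.
  by rewrite {1}t_lead !natrD !scalerDl.
have E2 : \sum_i \sum_a \sum_b (lead a b i)%:R *: t i a b =
    \sum_i \sum_a \sum_b (lead i a b)%:R *: t b i a.
  by rewrite exchange_big; apply: eq_bigr => a _; rewrite exchange_big.
have E3 : \sum_i \sum_a \sum_b (lead b i a)%:R *: t i a b =
    \sum_i \sum_a \sum_b (lead i a b)%:R *: t a b i.
  rewrite (eq_bigr (fun i => \sum_b \sum_a (lead b i a)%:R *: t i a b)); last first.
    by move=> i _; rewrite exchange_big.
  by rewrite exchange_big.
rewrite E E2 E3 -!big_split big1 // => i _; rewrite -!big_split big1 // => a _.
rewrite -!big_split big1 // => b _ /=.
by rewrite -!scalerDr addrAC t_cycle scaler0.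
Qed.

(** This expresses d(d(xi_al)) = 0. The antisymmetry of the structure constants makes both halves of
    the commutator equal to - [P], and 2 [P] is the total sum of [t]. *)
Lemma opK_opW_even : opK * opW al = opW al * opK.
Proof.
apply: (scalerI two_neq0).
pose P := \sum_i \sum_j kap i j al *: (opE i * opW j).
have W2 : 2%:R *: opW al = \sum_i \sum_j kap i j al *: (opE i * opE j).
  by rewrite opWE scalerA divff // scale1r.
have KW i j : opK * (opE i * opE j) = opE i * opE j * opK + (opW i * opE j - opE i * opW j).
  rewrite mulrA (canRL (addrK _) (opK_opE i)) mulrBl -!mulrA (canRL (addrK _) (opK_opE j)).
  by rewrite mulrBr opprB addrCA.
have P2 : \sum_i \sum_j kap i j al *: (opW i * opE j) = - P.
  rewrite exchange_big /P -sumrN; apply: eq_bigr => i _; rewrite -sumrN; apply: eq_bigr => j _.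
  rewrite -scalerN; have -> : opW j * opE i = ks i j *: (opE i * opW j).
    by rewrite opE_opW scalerA ksignK scale1r.
  rewrite scalerN -scaleNr scalerA; congr (_ *: _).
  rewrite /kap (strc_antisym j i) (ksignC j i).
  transitivity (- ((ks i j * ks i j) * (ks i j * strc i j al))); first ring.
  by rewrite ksignK mul1r.
have P0 : P = 0.
  apply: (scalerI two_neq0); rewrite scaler0 -sum_t scaler_sumr.
  apply: eq_bigr => i _.
  pose u l (a b : gen g) := (kap i l al * kap a b l) *: (opE i * opE a * opE b).
  transitivity (\sum_(a : gen g) \sum_(b : gen g) \sum_l u l a b); last first.
    apply: eq_bigr => a _; apply: eq_bigr => b _; rewrite -scaler_suml /t; congr (_ *: _).
    rewrite /jac lbr_bas (lin_sum (lbr_linearr _)) gdual_sum mulr_sumr.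
    apply: eq_bigr => l _; rewrite (linZ (lbr_linearr _)) gdualZ -/(strc i l al) /kap.
    have [->|/strc_par Pl] := eqVneq (strc a b l) 0; first by rewrite !(mulr0, mul0r).
    rewrite (ks_add i Pl); ring.
  transitivity (\sum_l \sum_(a : gen g) \sum_(b : gen g) u l a b); last first.
    by rewrite exchange_big; apply: eq_bigr => a _; rewrite exchange_big.
  rewrite scaler_sumr; apply: eq_bigr => l _.
  rewrite scale_swap opWE endoZr (scalerA 2%:R) divff // scale1r.
  rewrite mulr_sumr scaler_sumr; apply: eq_bigr => a _; rewrite mulr_sumr scaler_sumr.
  by apply: eq_bigr => b _; rewrite endoZr scalerA mulrA.
rewrite -endoZr -endoZl W2 mulr_sumr mulr_suml.
transitivity (\sum_i \sum_j (kap i j al *: (opE i * opE j * opK) +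
   kap i j al *: (opW i * opE j) - kap i j al *: (opE i * opW j))).
  apply: eq_bigr => i _; rewrite mulr_sumr; apply: eq_bigr => j _.
  by rewrite endoZr KW scalerDr scalerBr addrA.
rewrite (eq_bigr (fun i => \sum_j kap i j al *: (opE i * opE j * opK) +
  \sum_j kap i j al *: (opW i * opE j) - \sum_j kap i j al *: (opE i * opW j))); last first.
  by move=> i _; rewrite sumrB big_split.
rewrite sumrB big_split /= P2 -/P P0 oppr0 !addr0; apply: eq_bigr => i _.
by rewrite mulr_suml; apply: eq_bigr => j _; rewrite endoZl.
Qed.
End EvenGenerators.

(** * Cochains from operators *)

Definition one (v : V) : cochains := fun S m => if (S == set0) && (m == 0%MM) then v else 0.

Lemma one_linear : linear one.
Proof.
move=> x u v; apply: cochainP => S m; rewrite cochainD cochainZ /one.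
by case: ifP; rewrite ?scaler0 ?addr0.
Qed.

Lemma opA_one i v : opA i (one v) = 0.
Proof.
apply: cochainP => S m; rewrite opAE; case: i => j /=.
  case: ifP => // _; rewrite /one (_ : (j |: S == set0) = false) ?scaler0 //.
  by apply/negbTE/set0Pn; exists j; rewrite setU11.
rewrite /one (_ : ((m + U_(j))%MM == 0%MM) = false) ?andbF ?scaler0 //.
by rewrite -mdeg_eq0 mdegD mdeg1 addn1.
Qed.

Lemma opK_one v : opK (one v) = 0.
Proof.
rewrite opK_sum endo_sum big1 // => r _; rewrite endoM opA_one.
exact: lin0 (endo_linear _).
Qed.

Lemma opY_one f v S m : opY f (one v) S m = if S == set0 then f@_m *: v else 0.
Proof.
rewrite /= /mulpoly /one; case: eqP => [->|_] /=; last first.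
  by rewrite big1 // => n _; rewrite scaler0.
rewrite (bigD1 (BMultinom (ltnSn (mdeg m)))) /=; last by apply/mnm_lepP.
rewrite cards0 expr0 mulr1 ifT; last first.
  by apply/eqP/mnmP => i; rewrite mnmBE subnn mnm0E.
rewrite big1 ?addr0 // => n /andP[nm Nn]; rewrite ifF ?scaler0 //.
apply: contraNF Nn => /eqP E; apply/eqP/val_inj => /=.
by have := submK nm; rewrite E add0m.
Qed.

Lemma opV_one b (F : V -> V) (Fl : linear F) v : opV b Fl (one v) = one (F v).
Proof.
apply: cochainP => S m; rewrite opVE /one; case: ifP => [/andP[_ /eqP ->]|_].
  by rewrite mdeg0 andbF expr0 scale1r.
by rewrite (lin0 Fl) scaler0.
Qed.

Let M := Supermodule MS.

(* P stands for left multiplication by the cochain v |-> P (1 (x) v) of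
   Lambda_s(g^* ) (x) End(M), of odd total degree. *)
Lemma hom_kdiff_op (P : R) S m v :
  (forall i, P * opE i = - (opE i * P)) -> optau * P = P * optau ->
  hom_kdiff (fun S m (v : M) => P (one v) S m : M) S m v
  = (opD * P + P * opD : R) (one v) S m.
Proof.
move=> PE Pt; rewrite endoD cochainD !endoM.
have PD : P (opD (one v)) = \sum_i opE i (P (one (act MS (gbas i) v))).
  rewrite opD_def endoD endoN opK_one sub0r (linN (endo_linear P)).
  rewrite opQ_sum endo_sum (lin_sum (endo_linear P)) -sumrN; apply: eq_bigr => i _.
  rewrite endoM [oprho i _]opV_one -endoM PE endoN opprK; exact: endoM.
rewrite PD cochain_sum opD_def endoD endoN cochainD cochainN opKE opQ_sum endo_sum cochain_sum.
rewrite /hom_kdiff -addrA; congr (_ + _); rewrite addrC -opprB -sumrB; congr (- _).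
apply: eq_bigr => i _.
have El : linear (opE i) := endo_linear (opE i).
transitivity (opE i (oprho i (P (one v)) - P (one (act MS (gbas i) v))) S m); last first.
  by rewrite (linB El).
rewrite opEE; congr (mulgen i _ S m).
apply: cochainP => S' m'; rewrite cochainD cochainN opVE /hom_act scalerBr; congr (_ - _).
case: (gpar i); last by rewrite expr0 scale1r.
set w := act MS (gbas i) v.
(* Because P is even, its coefficient at y^m' is a map of parity [mdeg m']; its twist is the sign
   that cancels the one in [hom_kdiff]. *)
have E : P (one (spr MS false w - spr MS true w)) S' m' =
    sgn (odd (mdeg m')) *: (spr MS false (P (one w) S' m') - spr MS true (P (one w) S' m')).
  by rewrite -[RHS](opVE true psgn_lin) -endoM Pt endoM [optau _]opV_one.
rewrite [hom_twist _ _](_ : _ = sgn (odd (mdeg m')) *: P (one w) S' m'); last first.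
  transitivity (let u := P (one (spr MS false w - spr MS true w)) S' m' in
    spr MS false u - spr MS true u) => //.
  rewrite E /= !sprZ !sprB -scalerBr; congr (_ *: _).
  rewrite !spr_proj /= subr0 sub0r opprK; exact: spr_sum.
by rewrite scalerA -expr2 sqrr_sign scale1r.
Qed.

(** * Operators raising the exterior degree *)

(** The filtration by powers of the ideal generated by g_0^* : [raises 1] means vanishing modulo
    that ideal, [raises 0] preserving the filtration. *)
Definition raises n X := forall q c, (forall S m, (#|S| < q)%N -> c S m = 0) ->
  forall S m, (#|S| < q + n)%N -> X c S m = 0.

Lemma raises_add n X Y : raises n X -> raises n Y -> raises n (X + Y).
Proof.
move=> rX rY q c c0 S m Sq.
by rewrite endoD cochainD (rX _ _ c0) // (rY _ _ c0) // addr0.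
Qed.

Lemma raises_leq n n' X : (n <= n')%N -> raises n' X -> raises n X.
Proof.
move=> nn' rX q c c0 S m Sq; apply: rX c0 _ _ _.
by rewrite (leq_trans Sq) // leq_add2l.
Qed.

Lemma raises_scale n x X : raises n X -> raises n (x *: X).
Proof.
by move=> rX q c c0 S m Sq; rewrite endoZ cochainZ (rX _ _ c0) // scaler0.
Qed.

Lemma raises0 n : raises n 0.
Proof. by []. Qed.

Lemma raises_opp n X : raises n X -> raises n (- X).
Proof. by move=> rX; rewrite -scaleN1r; apply: raises_scale. Qed.

Lemma raises_sum n I (s : seq I) (P : pred I) (F : I -> R) :
  (forall i : I, P i -> raises n (F i)) -> raises n (\sum_(i <- s | P i) F i).
Proof.
by move=> rF; elim/big_ind: _ => // X Y; apply: raises_add.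
Qed.

Lemma raises_mul n n' X Y : raises n X -> raises n' Y -> raises (n + n') (X * Y).
Proof.
move=> rX rY q c c0 S m Sq; rewrite endoM; apply: (rX (q + n')%N).
  exact: rY.
by rewrite addnAC -addnA.
Qed.

Lemma raises1 : raises 0 1.
Proof. by move=> q c c0 S m; rewrite addn0 => /c0. Qed.

Lemma raises_exp n X (e : nat) : raises n X -> raises (n * e) (X ^+ e).
Proof.
move=> rX; elim: e => [|e IH]; first by rewrite muln0 expr0; apply: raises1.
by rewrite exprS mulnS; apply: raises_mul.
Qed.

Lemma raises_eq0 n X : (sdim g false < n)%N -> raises n X -> X = 0.
Proof.
move=> ltn rX; apply: endoP => c; apply: cochainP => S m.
apply: (rX 0%N) => //; rewrite add0n (leq_ltn_trans _ ltn) //.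
by have := max_card (mem S); rewrite card_ord.
Qed.

Lemma raises_opV b (F : V -> V) (Fl : linear F) : raises 0 (opV b Fl).
Proof. by move=> q c c0 S m; rewrite addn0 opVE => /c0 ->; rewrite (lin0 Fl) scaler0. Qed.

Lemma raises_opE i : raises (~~ gpar i) (opE i).
Proof.
move=> q c c0 S m; rewrite opEE; case: i => j /=.
  case: ifP => // jS; rewrite addn1 ltnS (cardsD1 j) jS add1n => Sq.
  by rewrite c0 ?scaler0.
by rewrite addn0 => Sq; case: ifP => // _; rewrite c0 ?scaler0.
Qed.

Lemma raises_opY f : raises 0 (opY f).
Proof.
elim/mpoly_mulX_ind: f => [x f h rf rh||j f rf].
- by rewrite opY_linear; apply: raises_add => //; apply: raises_scale.
- by rewrite opY1; apply: raises1.
- by rewrite opY_mulX; apply: (@raises_mul 0 0) => //; exact: (@raises_opE (inr j)).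
Qed.

Lemma raises_expB X Y (e : nat) : raises 0 X -> raises 1 (Y - X) -> raises 1 (Y ^+ e - X ^+ e).
Proof.
move=> rX rYX.
have rY : raises 0 Y.
  rewrite -(addrNK X Y); apply: raises_add => // q c c0 S m; rewrite addn0 => Sq.
  by apply: (rYX q) => //; rewrite addn1 ltnS ltnW.
elim: e => [|e IH]; first by rewrite !expr0 subrr; apply: raises0.
have -> : Y ^+ e.+1 - X ^+ e.+1 = Y * (Y ^+ e - X ^+ e) + (Y - X) * X ^+ e.
  by rewrite !exprS mulrBr mulrBl addrA addrNK.
apply: raises_add; first exact: (@raises_mul 0 1).
apply: (@raises_mul 1 0) => //.
by have := @raises_exp 0 X e rX; rewrite mul0n.
Qed.

(** * Nullhomotopies of Frobenius powers *)

Section FrobeniusPowers.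
Variable p : nat.
Hypothesis p_char : p \in [pchar k].

(** The operator ring is not commutative, so Frobenius is additive only on commuting pairs. *)
Lemma frobenius_comm X Y : X * Y = Y * X -> (X + Y) ^+ p = X ^+ p + Y ^+ p.
Proof.
have pp := pcharf_prime p_char.
have defp := prednK (prime_gt0 pp).
move=> XY; rewrite exprDn_comm // big_ord_recr subnn -defp big_ord_recl /= defp.
rewrite subn0 mulr1 mul1r bin0 binn big1 ?addr0 // => i _.
by rewrite -scaler_nat (bin_lt_pcharf_0 p_char) ?scale0r //= -{2}defp ltnS (valP i).
Qed.

Lemma frobenius_iter_comm X Y (e : nat) : X * Y = Y * X ->
  (X + Y) ^+ (p ^ e) = X ^+ (p ^ e) + Y ^+ (p ^ e).
Proof.
move=> XY; elim: e => [|e IH]; first by rewrite expn0 !expr1.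
rewrite expnSr !exprM IH frobenius_comm //.
exact/commrX/commr_sym/commrX/commr_sym.
Qed.

Lemma frobenius_iter_sum (I : eqType) (s : seq I) (F : I -> R) (e : nat) :
  (forall i j : I, F i * F j = F j * F i) ->
  (\sum_(i <- s) F i) ^+ (p ^ e) = \sum_(i <- s) F i ^+ (p ^ e).
Proof.
move=> FC; elim: s => [|i s IH].
  by rewrite !big_nil expr0n expn_eq0 gtn_eqF // prime_gt0 // (pcharf_prime p_char).
rewrite !big_cons frobenius_iter_comm ?IH //.
by rewrite mulr_sumr mulr_suml; apply: eq_bigr.
Qed.

Variables (s : R) (chi : {poly {mpoly k[d]}}).
Let w := opD * s + s * opD.
Hypotheses (sE : forall i, s * opE i = - (opE i * s)) (st : optau * s = s * optau).
Hypothesis sD2 : opD * opD * s = s * (opD * opD).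
Hypothesis chi_even : forall i : nat, ysign chi`_i = chi`_i.
Hypothesis chi_w : raises 1 (\sum_(i < size chi) opY chi`_i * w ^+ i).

Let sW i : s * opW i = opW i * s.
Proof.
rewrite opWE endoZr endoZl; congr (_ *: _).
rewrite mulr_sumr mulr_suml; apply: eq_bigr => j _.
rewrite mulr_sumr mulr_suml; apply: eq_bigr => l _.
by rewrite endoZr endoZl; congr (_ *: _); rewrite mulrA sE mulNr -(mulrA (opE j) s) sE mulrN opprK mulrA.
Qed.

Let wE i : w * opE i = opE i * w.
Proof.
have DE := canRL (addrK _) (opD_opE i).
have E1 : opD * s * opE i = opE i * (opD * s) - opW i * s.
  by rewrite -mulrA sE mulrN (mulrA opD) DE mulrBl opprB mulrA.
have E2 : s * opD * opE i = opW i * s + opE i * (s * opD).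
  by rewrite -(mulrA s) DE mulrBr sW [s * (opE i * _)]mulrA sE mulNr opprK mulrA.
by rewrite /w mulrDl mulrDr E1 E2 addrA addrNK.
Qed.

(** D s D occurs on both sides, so the claim amounts to s commuting with D^2. *)
Let wD : w * opD = opD * w.
Proof.
rewrite /w mulrDl mulrDr -(mulrA s) -sD2 (mulrA opD opD) (mulrA opD s).
exact: addrC.
Qed.

Let wY f : ysign f = f -> w * opY f = opY f * w.
Proof.
move=> sf; have := @opY_semicommutes false w f; rewrite /= expr0; apply=> j.
by rewrite scale1r wE.
Qed.

Let wt : optau * w = w * optau.
Proof.
rewrite /w mulrDl mulrDr; congr (_ + _).
  by rewrite mulrA optau_opD -mulrA st mulrA.
by rewrite mulrA st -mulrA optau_opD mulrA.
Qed.

(** As w commutes with D, w^m = D (s w^(m-1)) + (s w^(m-1)) D for m > 0. Every term of the powered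
    relation other than the constant one is therefore visibly nullhomotopic. *)
Lemma nullhomotopy_exists : exists (e : nat) (P : R),
  [/\ forall i, P * opE i = - (opE i * P), optau * P = P * optau
    & opD * P + P * opD = opY ((chi`_0 ^+ (p ^ e)) ^+ p)].
Proof.
have pp := pcharf_prime p_char.
(* p^(e+1) exceeds e = dim g_0, beyond which an operator raising the exterior degree has zero power;
   one factor p is kept for the power taken by [phi]. *)
pose e := sdim g false; pose N := (p ^ e.+1)%N.
have N_gt : (sdim g false < N)%N.
  by rewrite (leq_trans _ (ltn_expl e.+1 (prime_gt1 pp))) // ltnW.
have N_gt0 : (0 < N)%N by rewrite expn_gt0 prime_gt0.
have fN (h : {mpoly k[d]}) : (h ^+ (p ^ e)) ^+ p = h ^+ N by rewrite -exprM -expnSr.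
exists e; rewrite fN.
have [/eqP|] := posnP (size chi).
  rewrite size_poly_eq0 => /eqP ->; exists 0.
  rewrite coef0 expr0n gtn_eqF // opY0 !mulr0 !mul0r addr0.
  by split=> // i; rewrite mul0r mulr0 oppr0.
case: (size chi) chi_w => // n chi_raises _.
have wYc (i : nat) : GRing.comm w (opY chi`_i) by apply: wY.
have FC (i j : 'I_n.+1) : opY chi`_i * w ^+ i * (opY chi`_j * w ^+ j) =
    opY chi`_j * w ^+ j * (opY chi`_i * w ^+ i).
  have wiY (a b : nat) : GRing.comm (w ^+ a) (opY chi`_b).
    exact/commr_sym/commrX/commr_sym.
  have wiw (a b : nat) : GRing.comm (w ^+ a) (w ^+ b) by rewrite /GRing.comm -!exprD addnC.
  have YY (a b : nat) : GRing.comm (opY chi`_a) (opY chi`_b) by apply: opY_comm.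
  by apply: commrM; apply/commr_sym/commrM => //; apply: commr_sym.
have wN : \sum_(i < n.+1) opY (chi`_i ^+ N) * w ^+ (i * N) = 0.
  transitivity ((\sum_(i < n.+1) opY chi`_i * w ^+ i) ^+ N).
    rewrite frobenius_iter_sum //; apply: eq_bigr => i _.
    rewrite exprMn_comm; last exact/commrX/commr_sym.
    by rewrite opYX_exp exprM.
  apply: raises_eq0 N_gt _.
  by have := @raises_exp 1 _ N chi_raises; rewrite mul1n.
exists (- \sum_(i < n) opY (chi`_i.+1 ^+ N) * (s * w ^+ (i.+1 * N).-1)).
have even_pow (i : nat) : ysign (chi`_i ^+ N) = chi`_i ^+ N by rewrite rmorphXn /= chi_even.
have YD (i : nat) : opD * opY (chi`_i ^+ N) = opY (chi`_i ^+ N) * opD.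
  rewrite opD_def mulrBl mulrBr opQ_opY // -fN opK_opYp //.
  by rewrite rmorphXn /= chi_even.
have wmE (m : nat) i : w ^+ m * opE i = opE i * w ^+ m by apply/commr_sym/commrX/commr_sym/wE.
have wmt (m : nat) : optau * w ^+ m = w ^+ m * optau by apply/commrX/wt.
split.
- move=> i; rewrite mulNr mulrN; congr (- _); rewrite mulr_suml mulr_sumr -sumrN.
  apply: eq_bigr => j _; rewrite -!mulrA wmE [s * (opE i * _)]mulrA sE mulNr mulrN.
  congr (- _); rewrite [RHS]mulrA opE_opY iter_ysign //.
  by rewrite -!mulrA.
- rewrite mulNr mulrN; congr (- _); rewrite mulr_suml mulr_sumr.
  apply: eq_bigr => j _.
  have tY : optau * opY (chi`_j.+1 ^+ N) = opY (chi`_j.+1 ^+ N) * optau.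
    by rewrite [LHS]opV_opY iter_ysign.
  by rewrite (mulrA optau) tY -!mulrA; congr (_ * _); rewrite (mulrA optau) st -!mulrA wmt.
- move: wN; rewrite big_ord_recl /= mul0n expr0 mulr1 => /(canRL (addrK _)).
  rewrite sub0r => ->; rewrite mulNr mulrN -opprD; congr (- _).
  rewrite mulr_suml mulr_sumr -big_split; apply: eq_bigr => i _ /=.
  rewrite (mulrA opD) YD -!mulrA -mulrDr; congr (_ * _).
  set m := (bump 0 i * N)%N; have m0 : (0 < m)%N by rewrite muln_gt0 N_gt0.
  rewrite -[in RHS](prednK m0) exprS /w mulrDl -!mulrA; congr (_ * _ + _ * _).
  by apply/commr_sym/commrX/commr_sym/wD.
Qed.
End FrobeniusPowers.
End KoszulOperators.

(** * From nullhomotopies to the annihilator ideal *)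

Section Annihilators.
Variables (k : fieldType) (g : lieSuperalgebra k).
Local Notation d := (sdim g true).
Implicit Types (i j r : gen g) (S : mono0 g) (m : mono1 g).

Lemma kcocycle_phi p (f : {mpoly k[d]}) : p \in [pchar k] -> kcocycle (phi p f).
Proof.
move=> pk S m.
pose c : cochains g k^o := opY k^o (f ^+ p) (one (1 : k^o)).
rewrite [superext_cochain _](_ : _ = c); last first.
  apply: cochainP => S' m'; rewrite /c opY_one /superext_cochain /phi.
  by case: ifP => _; rewrite ?mcoeff0 //; apply/esym/mulr1.
rewrite -opKE /c -endoM opK_opY endoD endoM opK_one.
rewrite big1 => [|j _]; first by rewrite addr0 (lin0 (endo_linear _)).
by rewrite mderiv_expp // opY0 mulr0.
Qed.

Variables (V : lmodType k) (MS : smodStruct g V).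
Let M := Supermodule MS.

Lemma mulgen_comp (W W' : lmodType k) (G : W -> W') i (c : cochain g W) S m :
  linear G -> mulgen i (fun S m => G (c S m)) S m = G (mulgen i c S m).
Proof.
by move=> Gl; case: i => j /=; case: ifP => _; rewrite ?(linZ Gl) ?(lin0 Gl).
Qed.

Lemma dergen_comp (W W' : lmodType k) (G : W -> W') i (c : cochain g W) S m :
  linear G -> dergen i (fun S m => G (c S m)) S m = G (dergen i c S m).
Proof.
by move=> Gl; case: i => j /=; try case: ifP => _; rewrite ?(linZ Gl) ?(lin0 Gl).
Qed.

Lemma eq_mulgen (W : lmodType k) i (c e : cochain g W) S m :
  (forall S m, c S m = e S m) -> mulgen i c S m = mulgen i e S m.
Proof. by move=> E; case: i => j /=; rewrite E. Qed.

Lemma hom_kdiff_comp (N N' : supermodule g) (G : N -> N') (c : cochain g (M -> N)) S m v :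
  even_hom G -> hom_kdiff (fun S m v => G (c S m v)) S m v = G (hom_kdiff c S m v).
Proof.
move=> Gh; have Gl := even_hom_linear Gh.
rewrite /hom_kdiff (linB Gl) (lin_sum Gl); congr (_ - _).
  rewrite /kdiff (linZ Gl) (lin_sum Gl); congr (_ *: _); apply: eq_bigr => i _.
  rewrite (lin_sum Gl); apply: eq_bigr => j _; rewrite (lin_sum Gl); apply: eq_bigr => r _.
  rewrite (linZ Gl); congr (_ *: _); rewrite -(mulgen_comp _ _ _ _ Gl); apply: eq_mulgen => S' m'.
  rewrite -(mulgen_comp _ _ _ _ Gl); apply: eq_mulgen => S2 m2.
  by rewrite dergen_comp.
apply: eq_bigr => i _; rewrite -(mulgen_comp _ _ _ _ Gl); apply: eq_mulgen => S' m'.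
rewrite (linZ Gl); congr (_ *: _); rewrite /hom_act (linB Gl) (even_hom_act _ _ Gh); congr (_ - _).
case: (gpar i) => //; rewrite /hom_twist (linB Gl).
by rewrite !(even_hom_proj _ _ Gh).
Qed.

Lemma even_hom0 (N N' : supermodule g) : even_hom (fun _ : N => 0 : N').
Proof.
apply: even_homP => [a u v|a v|x v]; first by rewrite scaler0 addr0.
  exact: spr0.
by rewrite /sact act0.
Qed.

Lemma mulgen_00 (W : lmodType k) i (c : cochain g W) : mulgen i c set0 0%MM = 0.
Proof. by case: i => j /=; rewrite ?inE ?mnm0E. Qed.

(** The class bounds already in Koszul cochains with values in M. Composing the bounding cochain
    with [eta] gives the first lift, and [delta] kills it, so the rest of the descent is 0. *)
Lemma J_ideal_of_nullhomotopy p (f : {mpoly k[d]}) (P : endo (cochains g V)) :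
  p \in [pchar k] ->
  (forall i, P * opE V i = - (opE V i * P)) -> optau MS * P = P * optau MS ->
  opD MS * P + P * opD MS = opY V (f ^+ p) ->
  J_ideal p M f.
Proof.
move=> pk PE Pt DP; split; first exact: kcocycle_phi.
have [J [eta [delta res]]] := injective_resolution_exists M.
exists J, eta, delta; split=> // n.
pose H : cochain g (M -> M) := fun S m v => P (one v) S m.
have DH S m v : hom_kdiff H S m v = (phi p f S)@_m *: v.
  rewrite [LHS]hom_kdiff_op // DP opY_one /phi; case: ifP => // _.
  by rewrite mcoeff0 scale0r.
have etal := even_hom_linear (ires_eta res).
pose t b : cochain g (M -> J b) := match b with
  | 0 => fun S m v => eta ((phi p f S)@_m *: v) | b'.+1 => fun _ _ _ => 0 end.
pose h b : cochain g (M -> J b) := match b with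
  | 0 => fun S m v => eta (H S m v) | b'.+1 => fun _ _ _ => 0 end.
(* In degree 0 the constant coefficient itself must act by 0: a coboundary has no component on the
   monomial 1. *)
have f0 (v : M) : (phi p f set0)@_0%MM *: v = 0.
  rewrite -[LHS](DH set0 0%MM v) /hom_kdiff big1 ?subr0 => [|i _]; last by rewrite mulgen_00.
  rewrite /kdiff big1 ?scaler0 // => i _; rewrite big1 // => j _; rewrite big1 // => r _.
  by rewrite mulgen_00 scaler0.
exists (t n set0 0%MM).
  exists t, h; split=> // b bn; split.
  - case: b {bn} => [|b] S m x u v /=; last by rewrite scaler0 addr0.
    by rewrite -etal; congr eta; rewrite /H one_linear (endo_linear P).
  - move=> S m v _; case: b {bn} => [|b].
      by rewrite [LHS]hom_kdiff_comp ?DH //; apply: ires_eta res.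
    by rewrite [LHS](@hom_kdiff_comp M _ (fun=> 0) (fun _ _ => id)) //; apply: even_hom0.
  - move=> S m v _; case: b {bn} => [|b] /=.
      by symmetry; apply/(ires_exact0 res); eexists.
    by rewrite (lin0 (even_hom_linear (ires_delta res _))).
case: n => [|n] /=; first by move=> v; rewrite f0 (lin0 etal).
exists (fun=> 0) => [|v]; last by rewrite (lin0 (even_hom_linear (ires_delta res _))).
exists (fun=> 0), (fun=> 0); split; [exact: even_hom0| |by move=> v; rewrite addr0].
split=> [a u v|a v _|a x v _]; first by rewrite scaler0 addr0.
  exact: spr0.
by rewrite /sact act0 scaler0.
Qed.

End Annihilators.

(** * Elements of the annihilator not vanishing at a point *)

Section NonVanishing.
Variables (k : fieldType) (g : lieSuperalgebra k).
Variables (p : nat) (p_char : p \in [pchar k]) (two_neq0 : 2%:R != 0 :> k).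
Variable x : g.
Local Notation d := (sdim g true).
Implicit Types (i j r : gen g).

Lemma ysign_mulX (j l : 'I_d) : ysign ('X_j * 'X_l) = 'X_j * 'X_l.
Proof. by rewrite rmorphM /= !ysignX mulrNN. Qed.

Lemma J_ideal_square_neq0 (V : lmodType k) (MS : smodStruct g V) :
  x \in lpart g true -> lbr x x != 0 ->
  exists2 f, J_ideal p (Supermodule MS) f & f.@[pt x] != 0.
Proof.
move=> x_odd xx; have xx_even : lbr x x \in lpart g false := lbr_parity x_odd x_odd.
have [al alx] : exists al, gdual al (lbr x x) != 0.
  apply: contrapT => H; case/eqP: xx; rewrite (gbas_decomp (lbr x x)) big1 // => i _.
  case: (eqVneq (gdual i (lbr x x)) 0) => [->|ni]; first by rewrite scale0r.
  by case: H; exists i.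
have al_even : gpar al = false.
  by apply/negbTE; apply: contraNN alx => ao; apply/eqP/(gdual_par xx_even); rewrite ao.
(* d(xi_al) modulo the even generators. The minus sign is (-1)^(|i||j|) for two odd indices, and
   q(x) = -1/2 al([x, x]). *)
pose q : {mpoly k[d]} := \sum_(j < d) \sum_(l < d)
  (2%:R^-1 * - strc (inr j) (inr l) al) *: ('X_j * 'X_l).
have q_even : ysign q = q.
  rewrite rmorph_sum /=; apply: eq_bigr => j _; rewrite rmorph_sum /=.
  by apply: eq_bigr => l _; rewrite ysignZ ysign_mulX.
(* Here D s + s D is [opW al], which is the scalar [q] modulo the ideal, so the linear polynomial X
   - q replaces a characteristic polynomial. *)
pose E := opE V al; pose chi : {poly {mpoly k[d]}} := 'X - q%:P.
have wE : opD MS * E + E * opD MS = opW V al := opD_opE MS al.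
have sE i : E * opE V i = - (opE V i * E).
  by rewrite /E opE_comm /ksign al_even expr0 scaleN1r.
have st : optau MS * E = E * optau MS.
  by rewrite /E [LHS]opV_opE al_even expr0 scale1r.
have sD2 : opD MS * opD MS * E = E * (opD MS * opD MS).
  rewrite opD_sqr // /E -mulrA; have KE := canRL (addrK _) (opK_opE V al).
  rewrite KE mulrBr (mulrA (opK g V) (opE V al)) KE mulrBl (opK_opW_even _ two_neq0 al_even).
  by rewrite opprB addrC addrNK mulrA.
have chi_even (i : nat) : ysign chi`_i = chi`_i.
  rewrite /chi coefB coefX coefC rmorphB /= rmorph_nat; congr (_ - _).
  by case: eqP; rewrite ?rmorph0.
have chi_w : raises 1 (\sum_(i < size chi) opY V chi`_i * opW V al ^+ i).
  rewrite /chi size_XsubC big_ord_recl big_ord_recl big_ord0 addr0 /= !coefB !coefX !coefC /=.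
  rewrite sub0r subr0 expr0 mulr1 expr1 opY1 mul1r opYN.
  rewrite opWE scaler_sumr big_sumType /= addrCA; apply: raises_add.
    apply: raises_sum => i _; apply: raises_scale; apply: raises_sum => j _.
    apply: raises_scale; apply: (@raises_leq _ _ _ _ (1 + ~~ gpar j)%N) => //.
    by apply: raises_mul; [apply: (@raises_opE _ _ _ (inl i))|apply: raises_opE].
  rewrite opY_sum -sumrN -big_split; apply: raises_sum => j _ /=.
  rewrite opY_sum big_sumType scalerDr /= addrCA; apply: raises_add.
    rewrite scaler_sumr; apply: raises_sum => i _; do 2 apply: raises_scale.
    by apply: (@raises_mul _ _ _ 0 1); [apply: (@raises_opE _ _ _ (inr j))|apply: (@raises_opE _ _ _ (inl i))].
  rewrite scaler_sumr -sumrN -big_split big1 => [|l _]; first exact: raises0.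
  rewrite opYZ opY_mulX opYU scalerA /= /ksign /= expr1 mulN1r.
  by rewrite addNr.
rewrite -wE in chi_w.
have [e [P [PE Pt DP]]] := nullhomotopy_exists p_char sE st sD2 chi_even chi_w.
exists (chi`_0 ^+ (p ^ e)); first exact: J_ideal_of_nullhomotopy PE Pt DP.
rewrite rmorphXn expf_neq0 //= /chi coefB coefX coefC sub0r mevalN oppr_eq0.
suff -> : q.@[pt x] = 2%:R^-1 * - gdual al (lbr x x) by rewrite mulf_neq0 ?invr_eq0 ?oppr_eq0.
rewrite gdual_lbr big_sumType big1 => [|i _]; last first.
  by rewrite big1 // => j _; rewrite (gdual_even x_odd) !mul0r.
rewrite [X in _ * - X]add0r -sumrN mulr_sumr rmorph_sum /=; apply: eq_bigr => j _.
rewrite big_sumType big1 => [|l _]; last first.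
  by rewrite (gdual_even x_odd) mulr0 mul0r.
rewrite [X in _ * - X]add0r -sumrN mulr_sumr rmorph_sum /=; apply: eq_bigr => l _.
rewrite mevalZ mevalM !mevalXU -/(pt x j) -/(pt x l); ring.
Qed.

(** * Matrices over the polynomial ring acting on cochains *)

Section MatrixOperators.
Variables (V : lmodType k) (n : nat).
Variables (b : 'I_n.+1 -> V) (co : 'I_n.+1 -> V -> k^o).
Hypotheses (co_linear : forall a, linear (co a))
  (co_decomp : forall v, v = \sum_a co a v *: b a)
  (co_b : forall a c, co a (b c) = (a == c)%:R).
Local Notation R := (endo (cochains g V)).

Let unit_linear (a c : 'I_n.+1) : linear (fun v => co c v *: b a).
Proof. by move=> y u v; rewrite co_linear scalerDl -scalerA. Qed.
Let opU a c : R := opV g false (unit_linear a c).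

Let opU_mul a c a' c' : opU a c * opU a' c' = if c == a' then opU a c' else 0.
Proof.
rewrite opV_mul; apply: endoP => f; apply: cochainP => S m; rewrite opVE /= expr0 scale1r.
rewrite (linZ (co_linear c)) co_b; case: eqP => _; last first.
  by rewrite [_ *: 0%:R]mulr0 scale0r.
by rewrite [_ *: _%:R]mulr1 [RHS]opVE /= expr0 scale1r.
Qed.

Let opU_opY a c f : opU a c * opY V f = opY V f * opU a c.
Proof. exact: opV_opY. Qed.

(* The action of a matrix over S(g_1^* ) on the cochains with values in V. *)
Definition opM (G : 'M[{mpoly k[d]}]_n.+1) : R :=
  \sum_a \sum_c opY V (G a c) * opU a c.

Lemma opM_scale f G : opM (f *: G) = opY V f * opM G.
Proof.
rewrite mulr_sumr; apply: eq_bigr => a _; rewrite mulr_sumr; apply: eq_bigr => c _.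
by rewrite mxE opYM mulrA.
Qed.

Lemma opM_add G H : opM (G + H) = opM G + opM H.
Proof.
rewrite -big_split; apply: eq_bigr => a _; rewrite -big_split; apply: eq_bigr => c _.
by rewrite mxE opYD mulrDl.
Qed.

Lemma opM0 : opM 0 = 0.
Proof. by rewrite /opM big1 // => a _; rewrite big1 // => c _; rewrite mxE opY0 mul0r. Qed.

Lemma opM_sum I (s : seq I) (P : pred I) F :
  opM (\sum_(i <- s | P i) F i) = \sum_(i <- s | P i) opM (F i).
Proof. exact: (big_morph opM opM_add opM0). Qed.

Lemma opM1 : opM 1 = 1.
Proof.
apply: endoP => f; apply: cochainP => S m.
rewrite endo_sum cochain_sum endo1E [RHS]co_decomp; apply: eq_bigr => a _.
rewrite endo_sum cochain_sum (bigD1 a) // big1 => [|c ca].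
  by rewrite [LHS]addr0 mxE eqxx mulr1n opY1 mul1r opVE /= expr0 scale1r.
by rewrite mxE eq_sym (negPf ca) mulr0n opY0 mul0r.
Qed.

Lemma opM_mul G H : opM (G * H) = opM G * opM H.
Proof.
rewrite [in RHS]/opM mulr_suml; apply: eq_bigr => a _; rewrite mulr_suml.
transitivity (\sum_c \sum_e opY V (G a c * H c e) * opU a e).
  rewrite exchange_big; apply: eq_bigr => e _; rewrite -mulr_suml; congr (_ * _).
  by rewrite -opY_sum mxE.
have E c a' e : opY V (G a c) * opU a c * (opY V (H a' e) * opU a' e) =
    if c == a' then opY V (G a c * H c e) * opU a e else 0.
  rewrite -!mulrA (mulrA (opU a c)) opU_opY -!mulrA opU_mul opYM.
  by case: eqP => [->|_]; rewrite ?mulr0 // !mulrA.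
apply: eq_bigr => c _; rewrite mulr_sumr [in RHS](bigD1 c) //= [X in _ = _ + X]big1 => [|a' a'c].
  by rewrite [RHS]addr0 mulr_sumr; apply: eq_bigr => e _; rewrite E eqxx.
by rewrite mulr_sumr big1 // => e _; rewrite E eq_sym (negPf a'c).
Qed.

Lemma opM_exp G e : opM (G ^+ e) = opM G ^+ e.
Proof. by elim: e => [|e IH]; rewrite ?expr0 ?opM1 // !exprS opM_mul IH. Qed.

(** [opM] is a ring homomorphism taking scalars to [opY], so the matrix identity transfers. *)
Lemma opM_Cayley_Hamilton G :
  \sum_(i < size (char_poly G)) opY V (char_poly G)`_i * opM G ^+ i = 0.
Proof.
transitivity (opM (horner_mx G (char_poly G))); last by rewrite Cayley_Hamilton opM0.
rewrite -[in RHS](coefK (char_poly G)) poly_def rmorph_sum opM_sum.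
by apply: eq_bigr => i _; rewrite /= horner_mxZ rmorphXn /= horner_mx_X opM_scale opM_exp.
Qed.

Lemma opM_linear (F : 'I_d -> V -> V) (Fl : forall j : 'I_d, linear (F j)) :
  \sum_(j < d) opE V (inr j) * opV g false (Fl j)
  = opM (\matrix_(a, c) \sum_(j < d) co a (F j (b c)) *: 'X_j).
Proof.
pose T (j : 'I_d) a c : R := (co a (F j (b c)) : k) *: (opE V (inr j) * opU a c : R).
transitivity (\sum_(j < d) \sum_a \sum_c T j a c); last first.
  rewrite exchange_big; apply: eq_bigr => a _; rewrite exchange_big; apply: eq_bigr => c _.
  rewrite mxE opY_sum mulr_suml.
  by apply: eq_bigr => j _; rewrite opYZ opYU endoZl.
apply: eq_bigr => j _.
transitivity (opE V (inr j) * \sum_a \sum_c ((co a (F j (b c)) : k) *: (opU a c : R))); last first.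
  rewrite mulr_sumr; apply: eq_bigr => a _; rewrite mulr_sumr.
  by apply: eq_bigr => c _; rewrite endoZr.
congr (_ * _); apply: endoP => f; apply: cochainP => S m.
rewrite opVE /= expr0 scale1r endo_sum cochain_sum [LHS]co_decomp; apply: eq_bigr => a _.
rewrite endo_sum cochain_sum {1}(co_decomp (f S m)) (lin_sum (Fl j)) (lin_sum (co_linear a)).
rewrite scaler_suml; apply: eq_bigr => c _.
by rewrite endoZ cochainZ opVE expr0 scale1r (linZ (Fl j)) (linZ (co_linear a)) !scalerA mulrC.
Qed.

End MatrixOperators.

Lemma finite_basis (V : vectType k) : (0 < \dim {:V})%N ->
  exists n (b : 'I_n.+1 -> V) (co : 'I_n.+1 -> V -> k^o),
    [/\ forall a, linear (co a), forall v, v = \sum_a co a v *: b a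
      & forall a c, co a (b c) = (a == c)%:R].
Proof.
have [n En] : exists n, \dim {:V} = n by eexists.
rewrite En; case: n En => // n En _.
move: (vbasis {:V}) (vbasisP {:V}); rewrite En => X bX.
exists n, (fun a => X`_a), (fun a => coord X a); split=> [a|v|a c].
- exact: linearP.
- exact: (coord_basis bX (memvf v)).
- by rewrite coord_free ?(basis_free bX) // eq_sym.
Qed.

Lemma pt_decomp : x \in lpart g true -> x = \sum_(j < d) pt x j *: gbas (inr j).
Proof.
move=> x_odd; rewrite {1}(gbas_decomp x) big_sumType big1 => [|i _]; first exact: add0r.
by rewrite (gdual_even x_odd) scale0r.
Qed.

Lemma J_ideal_contractible (V : vectType k) (MS : smodStruct g V) :
  (0 < \dim {:V})%N -> x \in lpart g true -> contractible MS x ->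
  exists2 f, J_ideal p (Supermodule MS) f & f.@[pt x] != 0.
Proof.
move=> Vn0 x_odd [s [sl s_odd sx]].
have [n [b [co [co_lin co_dec co_b]]]] := finite_basis Vn0.
pose D := opD MS; pose K := opK g V; pose st := opV g true sl.
have stE i : st * opE V i = (-1) ^+ gpar i *: (opE V i * st) := opV_opE true sl i.
have stK : st * K = K * st.
  by apply: (@semicommutes_opK _ _ _ true) => i; [exact: opV_opE|exact: opV_opA].
have stt : optau MS * st = - (st * optau MS).
  rewrite [optau MS * st]opV_mul [st * optau MS]opV_mul.
  apply: endoP => c; apply: cochainP => S m; rewrite endoN cochainN !opVE /= expr0 !scale1r.
  by rewrite !s_odd /= (linB sl) opprB.
have DD : D * D = K * K := opD_sqr MS two_neq0.
(* [st] has odd parity and Z-degree 0, D even parity and Z-degree 1, so their graded commutator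
   carries no sign. It anticommutes with D because [st] commutes with D^2 = K^2. *)
pose u := D * st - st * D.
have uD : u * D = - (D * u).
  rewrite /u mulrBl mulrBr opprB -(mulrA st D D) (mulrA D D st) DD.
  by rewrite -(mulrA K) -stK (mulrA K) -stK !mulrA.
have stW i : st * opW V i = (-1) ^+ gpar i *: (opW V i * st).
  by apply: (@semicommutes_opW _ _ _ true) => l; exact: opV_opE.
have uE i : u * opE V i = - ((-1) ^+ gpar i *: (opE V i * u)).
  have DE := canRL (addrK _) (opD_opE MS i); rewrite -/D in DE.
  have E1 : D * st * opE V i =
      (-1) ^+ gpar i *: (opW V i * st) - (-1) ^+ gpar i *: (opE V i * (D * st)).
    by rewrite -(mulrA D) stE endoZr (mulrA D) DE mulrBl scalerBr mulrA.
  have E2 : st * D * opE V i =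
      (-1) ^+ gpar i *: (opW V i * st) - (-1) ^+ gpar i *: (opE V i * (st * D)).
    by rewrite -(mulrA st) DE mulrBr stW (mulrA st) stE endoZl -mulrA.
  rewrite /u mulrBl E1 E2 mulrBr scalerBr opprB.
  move: (_ *: (opW V i * st)) (_ *: (opE V i * (D * st))) (_ *: (opE V i * (st * D))) => X Y Z.
  by rewrite opprB addrC addrA addrNK.
have sE i : st * u * opE V i = - (opE V i * (st * u)).
  rewrite -(mulrA st) uE mulrN endoZr (mulrA st) stE endoZl scalerA -mulrA.
  by rewrite -expr2 sqrr_sign scale1r.
have tt : optau MS * (st * u) = st * u * optau MS.
  have tD : optau MS * D = D * optau MS := optau_opD MS.
  have tu : optau MS * u = - (u * optau MS).
    have e1 : optau MS * (D * st) = - (D * st * optau MS).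
      by rewrite mulrA tD -(mulrA D) stt mulrN mulrA.
    have e2 : optau MS * (st * D) = - (st * D * optau MS).
      by rewrite mulrA stt mulNr -(mulrA st _ D) tD mulrA.
    by rewrite /u mulrBr mulrBl e1 e2 opprK opprB addrC.
  by rewrite (mulrA (optau MS)) stt mulNr -(mulrA st _ u) tu mulrN opprK mulrA.
have wE : D * (st * u) + st * u * D = u * u.
  by rewrite -(mulrA st) uD mulrN !mulrA -mulrBl.
have DDs : D * D * (st * u) = st * u * (D * D).
  have -> : st * u * (D * D) = st * (D * D) * u.
    rewrite -!(mulrA st); congr (_ * _).
    by rewrite (mulrA u) uD mulNr -(mulrA D u) uD mulrN opprK mulrA.
  by rewrite DD mulrA (mulrA st K) stK -(mulrA K st) stK !mulrA.
(* Modulo the even generators u is the sum of the y_j B_j: minus the anticommutator of s with the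
   generic odd element. *)
pose B (j : 'I_d) (v : V) := - (act MS (gbas (inr j)) (s v) + s (act MS (gbas (inr j)) v)).
have Bl (j : 'I_d) : linear (B j).
  move=> c v w; rewrite /B sl !act_linearr sl addrACA -scalerDr opprD.
  by rewrite -scalerN.
pose G : 'M[{mpoly k[d]}]_n.+1 := \matrix_(a, c) \sum_(j < d) co a (B j (b c)) *: 'X_j.
pose L := opM b co_lin G.
have LE : L = \sum_(j < d) opE V (inr j) * opV g false (Bl j).
  by rewrite (opM_linear co_lin co_dec).
have rL : raises 0 L.
  rewrite LE; apply: raises_sum => j _.
  by apply: (@raises_mul _ _ _ 0 0); [exact: (@raises_opE _ _ _ (inr j))|exact: raises_opV].
have ruL : raises 1 (u - L).
  (* The Koszul part K drops out of the commutator since it commutes with [st]. *)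
  have -> : u = - \sum_i opE V i * (oprho MS i * st - (-1) ^+ gpar i *: (st * oprho MS i)).
    rewrite /u /D opD_def mulrBl mulrBr -/K stK opprB addrC addrA addrNK -opprB.
    congr (- _); rewrite opQ_sum mulr_suml mulr_sumr -sumrB; apply: eq_bigr => i _.
    by rewrite mulrBr endoZr !mulrA stE endoZl.
  rewrite LE big_sumType opprD -addrA; apply: raises_add.
    apply/raises_opp/raises_sum => i _; apply: (@raises_mul _ _ _ 1 0).
      exact: (@raises_opE _ _ _ (inl i)).
    apply: raises_add; last apply/raises_opp/raises_scale;
      by apply: (@raises_mul _ _ _ 0 0); exact: raises_opV.
  rewrite -opprD -big_split big1 ?oppr0 // => j _ /=.
  rewrite -mulrDr (_ : _ + _ = 0) ?mulr0 //.
  apply: endoP => c; apply: cochainP => S m.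
  rewrite !opV_mul expr1 scaleN1r opprK !endoD !cochainD !opVE /= expr0 !scale1r.
  exact: subrr.
(* The entries of G are linear forms, so those of its square are invariant under [ysign], and with
   them the coefficients of chi. *)
pose chi := char_poly (G * G).
have ysG : map_mx (@ysign k g) G = - G.
  apply/matrixP => a c; rewrite !mxE rmorph_sum -sumrN; apply: eq_bigr => j _ /=.
  by rewrite ysignZ ysignX scalerN.
have chi_even (i : nat) : ysign chi`_i = chi`_i.
  rewrite -coef_map map_char_poly; congr (char_poly _)`_i.
  by rewrite map_mxM ysG mulNmx mulmxN opprK.
have chi_w : raises 1 (\sum_(i < size chi) opY V chi`_i * (u * u) ^+ i).
  have -> : \sum_(i < size chi) opY V chi`_i * (u * u) ^+ i =
      \sum_(i < size chi) opY V chi`_i * ((u * u) ^+ i - opM b co_lin (G * G) ^+ i).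
    under [RHS]eq_bigr => i _ do rewrite mulrBr.
    by rewrite sumrB (opM_Cayley_Hamilton co_lin co_dec co_b) subr0.
  apply: raises_sum => i _.
  apply: (@raises_mul _ _ _ 0 1); first exact: raises_opY.
  apply: raises_expB; rewrite (opM_mul _ co_b) -/L.
    exact: (@raises_mul _ _ _ 0 0).
  by have := @raises_expB _ _ _ _ _ 2 rL ruL; rewrite !expr2.
rewrite -wE in chi_w.
have [e [P [PE Pt DP]]] := nullhomotopy_exists p_char sE tt DDs chi_even chi_w.
exists (chi`_0 ^+ (p ^ e)); first exact: J_ideal_of_nullhomotopy PE Pt DP.
rewrite rmorphXn expf_neq0 //= char_poly_det rmorphM rmorphXn rmorphN1 /=.
rewrite -det_map_mx map_mxM.
(* The contraction identity x s + s x = 1 says that G(x) = -1, so the constant coefficient of chi is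
   a sign at x. *)
suff -> : map_mx (meval (pt x)) G = - 1.
  by rewrite mulNmx mulmxN opprK mulmx1 det1 mulr1 signr_eq0.
apply/matrixP => a c; rewrite !mxE rmorph_sum /= -co_b -[in RHS](sx (b c)).
have Ex v : act MS x v = \sum_(j < d) pt x j *: act MS (gbas (inr j)) v.
  by rewrite {1}(pt_decomp x_odd) act_suml; apply: eq_bigr => j _; rewrite actZl.
rewrite !Ex (lin_sum sl) -big_split (lin_sum (co_lin a)) -sumrN.
apply: eq_bigr => j _ /=; rewrite mevalZ mevalXU (linN (co_lin a)) (linZ sl).
by rewrite -scalerDr (linZ (co_lin a)) mulNr mulrC.
Qed.

End NonVanishing.

(** * Points of the support variety *)

Section SupportVarieties.
Variables (k : fieldType) (g : lieSuperalgebra k).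
Variables (p : nat) (p_char : p \in [pchar k]) (two_neq0 : 2%:R != 0 :> k).
Variable x : g.

Lemma supp_var_square0 (V : lmodType k) (MS : smodStruct g V) :
  supp_var p (Supermodule MS) x -> lbr x x = 0.
Proof.
move=> [x_odd xJ]; apply/eqP; apply: contraT => xx.
have [f fJ] := J_ideal_square_neq0 p_char two_neq0 MS x_odd xx.
by rewrite [f.@[_]]xJ ?eqxx.
Qed.

Lemma adx_act0 (V : lmodType k) (MS : smodStruct g V) (F : V -> V) v : linear F ->
  (forall v, act MS x v = 0) ->
  adx x (F : Supermodule MS -> Supermodule MS) v = 0.
Proof.
move=> Fl x0; rewrite /adx hom_twistE /sact !x0.
have psgnl := @psgn_linear k g (Supermodule MS).
by rewrite (lin0 psgnl) (lin0 Fl) (lin0 psgnl) subr0.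
Qed.

(** When x acts by 0 every ad x (W) vanishes, so f(x)^p annihilates a nonzero vector. *)
Lemma supp_var_act0 (V : vectType k) (MS : smodStruct g V) :
  (0 < \dim {:V})%N -> x \in lpart g true -> lbr x x = 0 ->
  (forall v, act MS x v = 0) -> supp_var p (Supermodule MS) x.
Proof.
move=> Vn0 x_odd xx0 x0; split=> // f fJ.
have [W Wl WE] := J_ideal_homotopy x_odd xx0 two_neq0 fJ.
have [v vn0] : exists v : V, v != 0.
  by exists (vpick {:V}); rewrite vpick0 -dimv_eq0 -lt0n.
have /eqP := WE v; rewrite adx_act0 // scaler_eq0 (negPf vn0) orbF expf_eq0.
by case/andP => _ /eqP.
Qed.

Lemma supp_var_trivial : x \in lpart g true -> lbr x x = 0 ->
  supp_var p (trivial_supermodule g) x.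
Proof.
move=> x_odd xx0; apply: (@supp_var_act0 k^o (trivial_struct g)) => //.
by rewrite dimvf.
Qed.

(** For M = 0 the constant 1 would annihilate and the zero locus would be empty; hence the condition
    on the dimension. *)
Lemma supp_var0 (V : vectType k) (MS : smodStruct g V) :
  (0 < \dim {:V})%N -> x = 0 -> supp_var p (Supermodule MS) x.
Proof.
move=> Vn0 x0; apply: supp_var_act0 => //; rewrite x0 ?mem0v //.
  exact: (lin0 (lbr_linearr _)).
exact: act0l.
Qed.

End SupportVarieties.

Theorem theorem4p3p1 (k : closedFieldType) (p : nat) (p_char : p \in [pchar k])
    (p_ge3 : (3 <= p)%N) (g : lieSuperalgebra k)
    (V : vectType k) (V_nz : (0 < \dim {:V})%N) (M : smodStruct g V) (x : g) :
  supp_var p (Supermodule M) x <->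
  (supp_var p (trivial_supermodule g) x /\ ~ free_over M x) \/ x = 0.
Proof.
have two_neq0 : 2%:R != 0 :> k.
  by rewrite -(dvdn_pcharf p_char) gtnNdvd.
split=> [xM|[[xk nfree]|]]; last exact: supp_var0.
  (* Every M is free over <0> = 0, which is why the point 0 is adjoined separately. *)
  have [->|x0] := eqVneq x 0; [by right|left].
  have xx0 := supp_var_square0 p_char two_neq0 xM; have [x_odd xJ] := xM.
  split=> [|xfree]; first exact: supp_var_trivial.
  have xcontr := free_contractible x_odd xx0 two_neq0 x0 xfree.
  have [f fJ] := J_ideal_contractible p_char two_neq0 V_nz x_odd xcontr.
  by rewrite [f.@[_]%R]xJ ?eqxx.
have xx0 := supp_var_square0 p_char two_neq0 xk; have [x_odd _] := xk.
have [x0|x0] := eqVneq x 0; first exact: supp_var0.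
split=> // f fJ; apply/eqP; apply: contraT => fx.
have [W Wl WE] := J_ideal_homotopy x_odd xx0 two_neq0 fJ.
case: nfree; apply: contractible_free => //.
apply: (adx_contractible x_odd two_neq0 Wl _ WE).
exact: expf_neq0.
Qed.
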